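(* Let $\Omega^*\subset\mathbb{R}^2$ be an equilateral triangle of area $S>0$ and let $\Omega\subset\mathbb{R}^2$ denote any triangle of the same area $S$. There exists a negative number $\alpha_0=\alpha_0(S)$, depending solely on the area $S$, such that for every $\alpha\in[\alpha_0,0)$ one has $$\frac{\lambda_1^\alpha(\Omega)}{\lambda_1^\alpha(\Omega^* )}\ge 1$$ provided that $|\Omega\setminus\Omega^*|$ is sufficiently small; that is, for every $\alpha\in[\alpha_0,0)$ there exists $\delta=\delta(\alpha,S)>0$ such that the inequality holds for every triangle $\Omega$ with $|\Omega|=|\Omega^*|=S$ and $|\Omega\setminus\Omega^*|<\delta$.
   Context: A triangle means the open, non-degenerate triangular domain in $\mathbb{R}^2$, and $|E|$ denotes the area (Lebesgue measure) of $E\subset\mathbb{R}^2$. For a bounded Lipschitz domain $\Omega\subset\mathbb{R}^2$ and $\alpha\in\mathbb{R}$, $\lambda_1^\alpha(\Omega)$ denotes the lowest eigenvalue of the Robin Laplacian ($-\Delta u=\lambda u$ in $\Omega$, $\frac{\partial u}{\partial n}+\alpha u=0$ on $\partial\Omega$, with $n$ the outward unit normal), i.e. $$\lambda_1^\alpha(\Omega)=\inf_{u\in H^1(\Omega),\,u\neq0}\frac{\int_\Omega|\nabla u|^2+\alpha\int_{\partial\Omega}|u|^2}{\int_\Omega|u|^2},$$ where the boundary integral is understood in the sense of traces. For $\alpha<0$ one has $\lambda_1^\alpha(\Omega)<0$, so the displayed inequality in the claim is equivalent to $\lambda_1^\alpha(\Omega)\le\lambda_1^\alpha(\Omega^* )$.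 *)

(* Defs.v *)
From HB Require Import structures.
From mathcomp Require Import all_boot all_order all_algebra.
From mathcomp Require Import all_classical all_reals all_analysis.
Set Implicit Arguments.
Unset Strict Implicit.
Unset Printing Implicit Defensive.
Import Order.TTheory GRing.Theory Num.Theory.
Import numFieldNormedType.Exports.
Local Open Scope classical_set_scope.
Local Open Scope ring_scope.

Notation area := (@lebesgue_measure _ \x @lebesgue_measure _)%E.

Section Plane.
Context {R : realType}.

(* The norm and distance that the library puts on [R * R] are the sup ones,
   hence explicit Euclidean versions. *)
Definition norm2sq (v : R * R) : R := v.1 ^+ 2 + v.2 ^+ 2.
Definition edist (p q : R * R) : R := Num.sqrt (norm2sq (q - p)).

Definition e1 : R * R := (1, 0).
Definition e2 : R * R := (0, 1).

Definition grad (f : R * R -> R) (x : R * R) : R * R :=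
  ('D_e1 f x, 'D_e2 f x).

Fixpoint Ck (k : nat) (f : R * R -> R) : Prop :=
  match k with
  | 0%N => continuous f
  | k'.+1 => [/\ forall x, derivable f x e1 /\ derivable f x e2,
                 Ck k' ('D_e1 f) & Ck k' ('D_e2 f)]
  end.

Definition smooth (f : R * R -> R) : Prop := forall k, Ck k f.

Definition test_function (D : set (R * R)) (phi : R * R -> R) : Prop :=
  let supp := closure [set x | phi x != 0] in
  [/\ smooth phi, compact supp & supp `<=` D].

Definition L2 (D : set (R * R)) (f : R * R -> R) : Prop :=
  measurable_fun (D : set (measurableTypeR R * measurableTypeR R)) f /\
  (\int[area]_(x in D) (f x ^+ 2)%:E < +oo)%E.

Definition weak_gradient (D : set (R * R)) (u : R * R -> R)
    (G : R * R -> R * R) : Prop :=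
  forall phi, test_function D phi ->
    (\int[area]_(x in D) (u x * 'D_e1 phi x) =
      - (\int[area]_(x in D) ((G x).1 * phi x))) /\
    (\int[area]_(x in D) (u x * 'D_e2 phi x) =
      - (\int[area]_(x in D) ((G x).2 * phi x))).

(* [u] is in H^1(D), with distributional gradient [G]. *)
Definition H1 (D : set (R * R)) (u : R * R -> R) (G : R * R -> R * R) : Prop :=
  [/\ L2 D u, L2 D (fun x => (G x).1), L2 D (fun x => (G x).2)
    & weak_gradient D u G].

Record triangle := Triangle {
  vertA : R * R;
  vertB : R * R;
  vertC : R * R;
  vert_nondegenerate :
    (vertB.1 - vertA.1) * (vertC.2 - vertA.2)
      - (vertB.2 - vertA.2) * (vertC.1 - vertA.1) != 0 }.

Definition interior_of (T : triangle) : set (R * R) :=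
  [set x | exists a b c : R,
    [/\ 0 < a, 0 < b, 0 < c, a + b + c = 1 &
        x = a *: vertA T + b *: vertB T + c *: vertC T]].

Definition equilateral (T : triangle) : Prop :=
  edist (vertA T) (vertB T) = edist (vertB T) (vertC T) /\
  edist (vertB T) (vertC T) = edist (vertC T) (vertA T).

Definition sides (T : triangle) : seq ((R * R) * (R * R)) :=
  [:: (vertA T, vertB T); (vertB T, vertC T); (vertC T, vertA T)].

Definition side_path (s : (R * R) * (R * R)) (t : R) : R * R :=
  s.1 + t *: (s.2 - s.1).

(* Integral over the boundary with respect to arc length. *)
Definition boundary_integral (T : triangle) (f : R * R -> R) : \bar R :=
  (\sum_(s <- sides T) (edist s.1 s.2)%:E *
     \int[@lebesgue_measure R]_(t in `[0%R, 1%R]) (f (side_path s t))%:E)%E.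

Definition L2_boundary (T : triangle) (g : R * R -> R) : Prop :=
  (forall s, s \in sides T ->
     measurable_fun (`[0, 1] : set (measurableTypeR R)) (fun t : R => g (side_path s t))) /\
  (boundary_integral T (fun x => (g x ^+ 2)%R) < +oo)%E.

(* The trace operator is the continuous extension to H^1 of the restriction
   of functions smooth up to the boundary: [g] is the trace of the H^1 function
   [u] (with distributional gradient [G]) when, for some sequence of smooth
   functions converging to [u] in H^1, the restrictions to the boundary converge
   to [g] in L^2.  Only the values of [g] on the boundary matter. *)
Definition trace (T : triangle) (u : R * R -> R) (G : R * R -> R * R)
    (g : R * R -> R) : Prop :=
  L2_boundary T g /\
  exists f : nat -> R * R -> R,
    [/\ forall n, smooth (f n),
        (fun n => \int[area]_(x in interior_of T) ((f n x - u x) ^+ 2)%:E)%E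
          @ \oo --> 0%E,
        (fun n => \int[area]_(x in interior_of T)
           (norm2sq (grad (f n) x - G x))%:E)%E @ \oo --> 0%E &
        (fun n => boundary_integral T (fun x => (f n x - g x) ^+ 2))
          @ \oo --> 0%E].

Definition rayleigh (alpha : R) (T : triangle) (u : R * R -> R)
    (G : R * R -> R * R) (g : R * R -> R) : R :=
  ((\int[area]_(x in interior_of T) norm2sq (G x))
     + alpha * fine (boundary_integral T (fun x => g x ^+ 2)))
  / (\int[area]_(x in interior_of T) (u x ^+ 2)).

(* u <> 0 is meant in H^1, that is, up to almost everywhere equality. *)
Definition robin_lambda1 (alpha : R) (T : triangle) : R :=
  inf [set r | exists u G g,
    [/\ H1 (interior_of T) u G, trace T u G g,
        ~ {ae area, forall x, interior_of T x -> u x = 0} &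
        r = rayleigh alpha T u G g]].

End Plane.

Arguments triangle R : clear implicits.

(* Main.v *)
Require Import Defs.
From HB Require Import structures.
From mathcomp Require Import all_boot all_order all_algebra.
From mathcomp Require Import all_classical all_reals all_analysis.
From mathcomp Require Import measurable_realfun ring lra.
Set Implicit Arguments.
Unset Strict Implicit.
Unset Printing Implicit Defensive.
Import Order.TTheory GRing.Theory Num.Theory.
Import numFieldNormedType.Exports.
Local Open Scope classical_set_scope.
Local Open Scope ring_scope.

(** Fix the area S, let U be the equilateral triangle, of side L, and T another
    triangle of area S.  Up to sign, both have the determinant d = 2 S.  For a smooth
    function f on U write N for the integral of f^2, D for the integral of
    |grad f|^2, both over U, and B for the integral of f^2 over the boundary.

    Test functions on T are obtained by composing f with the three affine maps
    from T to U that match the vertices cyclically.  They preserve area, hence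
    keep N.  On average over the three maps, the boundary integral is multiplied
    by p = P(T) / P(U), since each side of T is mapped once onto each side of U,
    and the Dirichlet integral is multiplied by q, the sum of the squared sides
    of T over that of U, since the three edge vectors of an equilateral triangle
    form a tight frame ([pullback_rot_sum]).  One of the three maps is at least
    as good as the average, so it is enough to have
      (q - 1) D <= |alpha| (p - 1) B.

    Heron's formula gives p >= 1 and q - 1 <= (3/2) (p + 1) (p - 1)
    ([heron_gap]): area-preserving deformations of U increase both quantities to
    the same order.  On the other side, integrating the derivative of
    (r f)^2 along the rays that leave a vertex gives the trace inequality
      d B <= 3 L ((2 + 1/eps) N + eps L^2 D)        ([bdry_trace])
    whose leading constant is the one of constant functions.  Now either the
    constant function on T already has a quotient below that of f, or
    D - |alpha| B < - |alpha| (P(T) / S) N.  In the second case the trace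
    inequality forces D to be of order alpha^2 N and B to be at least
    6 (L / d) N, so that the wanted inequality holds for small |alpha|;
    and it excludes p >= 2 ([comparison_algebra]).  The smallness condition
    48 |alpha| d <= L follows from a bound in terms of S alone, because d = 2 S and
    d <= L^2.

    To work with smooth functions only, one uses that the trace is defined by
    approximation: every competitor (u, G, g) in the definition of lambda_1 has a
    quotient which is a limit of quotients of smooth functions ([smooth_dense]),
    and every smooth function is a competitor ([smooth_admissible]).  The trace
    inequality also shows that the quotients are bounded below, without which
    [inf] would be a default value. *)

(** * Measurability and affine substitutions in the plane *)

(** The product sigma-algebra of the two Borel lines, over which the area is a
    measure. *)
Notation plane R := (measurableTypeR R * measurableTypeR R)%type.

Section Coordinates.
Context {R : realType}.
Implicit Types x y : R * R.

Lemma eq_plane x y : x.1 = y.1 -> x.2 = y.2 -> x = y.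
Proof. by case: x y => ? ? [? ?] /= -> ->. Qed.

Let fstD x y : (x + y).1 = x.1 + y.1. Proof. by []. Qed.
Let sndD x y : (x + y).2 = x.2 + y.2. Proof. by []. Qed.
Let fstB x y : (x - y).1 = x.1 - y.1. Proof. by []. Qed.
Let sndB x y : (x - y).2 = x.2 - y.2. Proof. by []. Qed.
Let fstZ (k : R) x : (k *: x).1 = k * x.1. Proof. by []. Qed.
Let sndZ (k : R) x : (k *: x).2 = k * x.2. Proof. by []. Qed.
Definition coordE := (fstB, sndB, fstD, sndD, fstZ, sndZ).

End Coordinates.

Section MeasurePlane.
Context {R : realType}.
Local Notation mu := (@lebesgue_measure R).

(** An open set is the union of the squares with rational centre and size that it
    contains, and there are only countably many of these. *)
Lemma open_measurable_plane (U : set (R * R)) :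
  open U -> measurable (U : set (plane R)).
Proof.
move=> oU.
pose box (p q e : R) : set (R * R) := `]p - e, p + e[%classic `*` `]q - e, q + e[%classic.
pose F (p q e : rat) : set (plane R) :=
  if `[< box (ratr p) (ratr q) (ratr e) `<=` U >]
  then box (ratr p) (ratr q) (ratr e) else set0.
have -> : U = \bigcup_p \bigcup_q \bigcup_e F p q e.
  apply/seteqP; split=> [[x1 x2] Ux|x [p _ [q _ [e _]]]]; last first.
    by rewrite /F; case: asboolP => // /[apply].
  have : nbhs (x1, x2) U by exact: open_nbhs_nbhs.
  move=> /nbhs_ballP[d /= d0 dU].
  have [e /=] : exists e, ratr e \in `]0, (d / 2 : R)[.
    by apply: rat_in_itvoo; rewrite divr_gt0.
  rewrite in_itv/= => /andP[e0 ed].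
  have [p /=] : exists p, ratr p \in `](x1 - ratr e), (x1 + ratr e)[.
    by apply: rat_in_itvoo; lra.
  rewrite in_itv/= => /andP[p1 p2].
  have [q /=] : exists q, ratr q \in `](x2 - ratr e), (x2 + ratr e)[.
    by apply: rat_in_itvoo; lra.
  rewrite in_itv/= => /andP[q1 q2].
  exists p => //; exists q => //; exists e => //.
  rewrite /F asboolT.
    by split; rewrite /= in_itv/=; apply/andP; split; lra.
  move=> [y1 y2] [/=]; rewrite !in_itv/= => /andP[y11 y12] /andP[y21 y22].
  apply: dU; split => /=; rewrite /ball/= ltr_norml; apply/andP; split; lra.
apply: bigcupT_measurable_rat => p; apply: bigcupT_measurable_rat => q.
apply: bigcupT_measurable_rat => e; rewrite /F; case: ifPn => // _.
exact: measurableX.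
Qed.

Lemma continuous_measurable_plane (f : R * R -> R) :
  continuous f -> measurable_fun setT (f : plane R -> R).
Proof.
move=> /continuousP cf; apply: (measurability _ (RGenOpens.measurableE R)).
move=> _ [_ [a [b ->] <-]]; rewrite setTI; apply: open_measurable_plane.
exact/cf/interval_open.
Qed.

Local Open Scope ereal_scope.

Lemma measurable_affine (a b : R) : measurable_fun setT (fun x : R => a * x + b)%R.
Proof.
by apply: continuous_measurable_fun => x; apply: cvgD; [apply: cvgMr; exact: cvg_id|exact: cvg_cst].
Qed.

(** Up to the factor |a|, the image of Lebesgue measure agrees with Lebesgue
    measure on half-open intervals, hence everywhere. *)
Lemma integral_affine (F : R -> \bar R) (a b : R) :
  measurable_fun setT F -> (forall x, 0 <= F x) -> a != 0%R ->
  \int[mu]_x F x = `|a|%:E * \int[mu]_x F (a * x + b)%R.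
Proof.
move=> mF F0 a0.
pose phi : measurableTypeR R -> measurableTypeR R := fun x : R => (a * x + b)%R.
have mphi : measurable_fun setT phi.
  exact: measurable_affine.
pose pf : {measure set (measurableTypeR R) -> \bar R} :=
  measure_function_pushforward__canonical__measure_function_Measure mu mphi.
pose m := mscale (NngNum (normr_ge0 a)) pf.
have mE : forall A, measurable A -> mu A = m A.
  apply: lebesgue_measure_unique => _ [[p q]] _ <-.
  rewrite /m /mscale /pf/= /pushforward.
  have [pq|qp] := ltP p q; last first.
    by rewrite set_itv_ge ?preimage_set0 ?measure0 ?mule0// bnd_simp -leNgt.
  case: (ltgtP a 0%R) => [an|ap|/eqP]; last by rewrite (negbTE a0).
    rewrite [X in _ = _ * mu X](_ : _ = `[((q - b) / a)%R, ((p - b) / a)%R[%classic).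
      rewrite !lebesgue_measure_itv/= !lte_fin pq ltr_nM2r ?invr_lt0//.
      by rewrite ltrD2r pq -!EFinB -EFinM ltr0_norm//; congr _%:E; field.
    apply/seteqP; split=> x /=; rewrite /phi !in_itv/= => /andP[].
      by move=> h1 h2; rewrite ler_ndivrMr// ltr_ndivlMr//; apply/andP; split; lra.
    by rewrite ler_ndivrMr// ltr_ndivlMr// => h1 h2; apply/andP; split; lra.
  rewrite [X in _ = _ * mu X](_ : _ = `]((p - b) / a)%R, ((q - b) / a)%R]%classic).
    rewrite !lebesgue_measure_itv/= !lte_fin pq ltr_pM2r ?invr_gt0//.
    by rewrite ltrD2r pq -!EFinB -EFinM gtr0_norm//; congr _%:E; field.
  apply/seteqP; split=> x /=; rewrite /phi !in_itv/= => /andP[].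
    by move=> h1 h2; rewrite ler_pdivlMr// ltr_pdivrMr//; apply/andP; split; lra.
  by rewrite ler_pdivlMr// ltr_pdivrMr// => h1 h2; apply/andP; split; lra.
rewrite (eq_measure_integral m); last by move=> A mA _; exact: mE.
by rewrite ge0_integral_mscale// ge0_integral_pushforward.
Qed.

Lemma measurable_affine_plane (a b c d e f : R) :
  measurable_fun setT
    ((fun z => (a * z.1 + b * z.2 + e, c * z.1 + d * z.2 + f)%R) : plane R -> plane R).
Proof.
by apply/measurable_fun_pairP; split; apply: measurable_funD => //;
  apply: measurable_funD => //; apply: measurable_funM.
Qed.

(** Substitute in the first coordinate with the second one fixed, exchange the
    order of integration, then substitute in the second coordinate.  The first step
    divides by [a]. *)
Lemma integral_affine_plane_aux (F : plane R -> \bar R) (a b c d e f : R) :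
  measurable_fun setT F -> (forall x, 0 <= F x) ->
  (a != 0)%R -> (a * d - b * c != 0)%R ->
  \int[area]_z F z = `|a * d - b * c|%:E *
    \int[area]_z F (a * z.1 + b * z.2 + e, c * z.1 + d * z.2 + f)%R.
Proof.
move=> mF F0 a0 det0.
have mL := measurable_affine_plane a b c d e f.
rewrite [in RHS]fubini_tonelli2//; last exact: measurableT_comp mF mL.
rewrite /fubini_G /=.
have inner y : \int[mu]_x F (a * x + b * y + e, c * x + d * y + f)%R =
    (`|a|^-1)%:E * \int[mu]_x F (x, c * ((x - b * y - e) / a) + d * y + f)%R.
  pose Fy (x : R) := F (x, c * ((x - b * y - e) / a) + d * y + f)%R.
    rewrite -[X in _ = _ * X]/(\int[mu]_x Fy x) (@integral_affine Fy a (b * y + e)) //.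
    - rewrite muleA -EFinM mulVf ?normr_eq0// mul1e.
      apply: eq_integral => x _; rewrite /Fy addrA; congr F; congr pair.
      by congr (_ + _ + _)%R; congr (_ * _)%R; field.
    - apply: (measurableT_comp mF); apply/measurable_fun_pairP; split => /=; first exact: measurable_id.
      rewrite [X in measurable_fun _ X](_ : _ = fun x : R =>
        (c / a * x + (d * y + f - c * (b * y + e) / a))%R).
        exact: measurable_affine.
      by apply/funext => x /=; field.
    - by move=> x; exact: F0.
under [in RHS]eq_integral => y _ do rewrite inner.
have mG : measurable_fun setT
    ((fun z => F (z.1, c * ((z.1 - b * z.2 - e) / a) + d * z.2 + f)%R) : plane R -> _).
  apply: (measurableT_comp mF).
  rewrite (_ : (fun _ => _) = (fun z : plane R => (1 * z.1 + 0 * z.2 + 0,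
     c / a * z.1 + (d - b * c / a) * z.2 + (f - c * e / a))%R)).
    exact: measurable_affine_plane.
  by apply/funext => -[x y] /=; congr pair; field.
rewrite ge0_integralZl//; first last.
- by move=> y _; exact: integral_ge0.
- by have := measurable_fun_fubini_tonelli_G (m1 := mu) _ mG (fun _ => F0 _).
rewrite -(fubini_tonelli (m1 := mu) (m2 := mu) _ mG (fun _ => F0 _))/=.
rewrite fubini_tonelli1// /fubini_F.
rewrite -ge0_integralZl//; first last.
- by move=> y _; exact: integral_ge0.
- by have := measurable_fun_fubini_tonelli_F (m2 := mu) _ mG (fun _ => F0 _).
rewrite -ge0_integralZl//; first last.
- by move=> y _; apply: mule_ge0 => //; exact: integral_ge0.
- apply: measurable_funeM.
  by have := measurable_fun_fubini_tonelli_F (m2 := mu) _ mG (fun _ => F0 _).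
apply: eq_integral => x _.
rewrite (@integral_affine (fun y => F (x, y)) ((a * d - b * c) / a)%R
  (c * ((x - e) / a) + f)%R)//.
- rewrite normrM normfV muleA -EFinM; congr (_ * _).
  by apply: eq_integral => y _; congr F; congr pair; field.
- exact: measurableT_comp.
- by rewrite mulf_neq0 ?invr_neq0.
Qed.

Lemma integral_swap_plane (F : plane R -> \bar R) :
  measurable_fun setT F -> (forall x, 0 <= F x) ->
  \int[area]_z F z = \int[area]_z F (z.2, z.1).
Proof.
move=> mF F0; rewrite [in RHS]fubini_tonelli2//.
  by rewrite fubini_tonelli1.
apply: (measurableT_comp mF); apply/measurable_fun_pairP.
by split; [exact: measurable_snd|exact: measurable_fst].
Qed.

(** When [a = 0], exchanging the two coordinates of the source puts [b] in the place
    of [a], and [b] is then nonzero. *)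
Lemma integral_affine_plane (F : plane R -> \bar R) (a b c d e f : R) :
  measurable_fun setT F -> (forall x, 0 <= F x) -> (a * d - b * c != 0)%R ->
  \int[area]_z F z = `|a * d - b * c|%:E *
    \int[area]_z F (a * z.1 + b * z.2 + e, c * z.1 + d * z.2 + f)%R.
Proof.
move=> mF F0 det0; have [a0|a0] := eqVneq a 0%R; last exact: integral_affine_plane_aux.
rewrite [in RHS]integral_swap_plane//=; last first.
  exact: measurableT_comp mF (measurable_affine_plane a b c d e f).
rewrite (@integral_affine_plane_aux F b a d c e f)//.
- rewrite distrC (mulrC b) (mulrC a); congr (_ * _).
  by apply: eq_integral => z _; congr F; congr pair; ring.
- by apply: contra_neq det0 => ->; rewrite a0; ring.
- by apply: contra_neq det0 => h; rewrite -oppr0 -h; ring.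
Qed.

End MeasurePlane.

(** * Coordinates along the rays from a vertex *)

Section Cone.
Context {R : realType}.
Local Notation mu := (@lebesgue_measure R).
Implicit Types (T : triangle R) (x : R * R).

Definition det2 T : R :=
  ((vertB T).1 - (vertA T).1) * ((vertC T).2 - (vertA T).2)
      - ((vertB T).2 - (vertA T).2) * ((vertC T).1 - (vertA T).1).

Lemma det2_neq0 T : det2 T != 0.
Proof. exact: vert_nondegenerate. Qed.

Definition baryB T x : R :=
  ((x.1 - (vertA T).1) * ((vertC T).2 - (vertA T).2)
      - (x.2 - (vertA T).2) * ((vertC T).1 - (vertA T).1)) / det2 T.

Definition baryC T x : R :=
  (((vertB T).1 - (vertA T).1) * (x.2 - (vertA T).2)
      - ((vertB T).2 - (vertA T).2) * (x.1 - (vertA T).1)) / det2 T.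

(** For a point of the triangle, [r] is the fraction of the way from the vertex A to
    the opposite side and [t / r] is the position on this side of the ray from A
    through the point. *)
Definition cone T (r t : R) : R * R :=
  vertA T + r *: (vertB T - vertA T) + t *: (vertC T - vertB T).

Lemma coneE T r t : cone T r t =
  ((vertA T).1 + r * ((vertB T).1 - (vertA T).1) + t * ((vertC T).1 - (vertB T).1),
   (vertA T).2 + r * ((vertB T).2 - (vertA T).2) + t * ((vertC T).2 - (vertB T).2)).
Proof. by []. Qed.

Lemma cone_bary T x : cone T (baryB T x + baryC T x) (baryC T x) = x.
Proof.
have := det2_neq0 T; rewrite coneE /baryB /baryC /det2.
case: T x => -[a1 a2] [b1 b2] [c1 c2] /= _ [x1 x2] d0 /=.
by congr pair; field.
Qed.

Lemma baryB_cone T r t : baryB T (cone T r t) = r - t.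
Proof.
have := det2_neq0 T; rewrite coneE /baryB /det2.
case: T => -[a1 a2] [b1 b2] [c1 c2] /= _ d0.
by apply: (mulIf d0); rewrite divfK//=; ring.
Qed.

Lemma baryC_cone T r t : baryC T (cone T r t) = t.
Proof.
have := det2_neq0 T; rewrite coneE /baryC /det2.
case: T => -[a1 a2] [b1 b2] [c1 c2] /= _ d0.
by apply: (mulIf d0); rewrite divfK//=; ring.
Qed.

Lemma interior_cone T r t : interior_of T (cone T r t) <-> [/\ 0 < t, t < r & r < 1].
Proof.
split=> [[a [b [c [a0 b0 c0 abc xE]]]]|[t0 tr r1]].
  have h : cone T r t = cone T (b + c) c.
    rewrite xE /cone (_ : a = 1 - b - c); last by rewrite -abc; ring.
    by apply: eq_plane; rewrite !coordE; ring.
  have tE : t = c by rewrite -(baryC_cone T r t) h baryC_cone.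
  have : r - t = b by rewrite -(baryB_cone T r t) h baryB_cone; ring.
  by move=> rt; split; lra.
exists (1 - r), (r - t), t; split; rewrite ?subr_gt0//; first by ring.
by apply: eq_plane; rewrite !coordE; ring.
Qed.

Lemma interior_baryE T x :
  interior_of T x <-> [/\ 0 < baryC T x, 0 < baryB T x & baryB T x + baryC T x < 1].
Proof.
rewrite -{1}(cone_bary T x) interior_cone.
by split=> -[? ? ?]; split => //; lra.
Qed.

Lemma continuous_baryB T : continuous (baryB T).
Proof.
move=> x; apply: cvgMl; apply: cvgB; apply: cvgMl; apply: cvgB;
  by [exact: cvg_fst|exact: cvg_snd|exact: cvg_cst].
Qed.

Lemma continuous_baryC T : continuous (baryC T).
Proof.
move=> x; apply: cvgMl; apply: cvgB; apply: cvgMr; apply: cvgB;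
  by [exact: cvg_fst|exact: cvg_snd|exact: cvg_cst].
Qed.

Lemma open_interior T : open (interior_of T).
Proof.
rewrite (_ : interior_of T = (baryC T @^-1` `]0, +oo[) `&` (baryB T @^-1` `]0, +oo[)
   `&` ((fun x => baryB T x + baryC T x) @^-1` `]-oo, 1[)).
  apply: openI; first apply: openI.
  - by apply: open_comp => [x _|]; [exact: continuous_baryC|exact: rray_open].
  - by apply: open_comp => [x _|]; [exact: continuous_baryB|exact: rray_open].
  - apply: open_comp => [x _|]; last exact: lray_open.
    by apply: cvgD; [exact: continuous_baryB|exact: continuous_baryC].
apply/seteqP; split=> x /=; rewrite interior_baryE !in_itv/= ?andbT.
  by case.
by case=> -[].
Qed.

Lemma measurable_interior T : measurable (interior_of T : set (plane R)).
Proof. by apply: open_measurable_plane; exact: open_interior. Qed.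

Local Open Scope ereal_scope.

(** Measurability in [s] of the inner integral of [cone_integral]; it is what allows
    inequalities between inner integrals to be integrated over the rays. *)
Lemma measurable_cone T (F : plane R -> \bar R) :
  measurable_fun setT F -> (forall x, 0 <= F x) ->
  measurable_fun setT (fun s : R => \int[mu]_(r in `]0%R, 1%R[)
      (r%:E * F (vertA T + r *: (side_path (vertB T, vertC T) s - vertA T))%R)).
Proof.
move=> mF F0.
pose P (z : R * R) : plane R := (vertA T + z.1 *: (side_path (vertB T, vertC T) z.2 - vertA T))%R.
have mP : measurable_fun setT (P : plane R -> plane R).
  apply/measurable_fun_pairP; split; apply: continuous_measurable_plane => z;
  (apply: cvgD; first exact: cvg_cst); apply: cvgM; (try exact: cvg_fst);
  (apply: cvgB; last exact: cvg_cst); (apply: cvgD; first exact: cvg_cst);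
  by apply: cvgMl; exact: cvg_snd.
pose K := (fun z : plane R => z.1%:E * F (P z)) \_ (`]0%R, 1%R[ `*` setT).
have K0 z : 0 <= K z.
  rewrite /K patchE; case: ifPn => // /set_mem[/=]; rewrite in_itv/= => /andP[z0 _] _.
  by rewrite mule_ge0// lee_fin ltW.
have mK : measurable_fun setT K.
  have mD : measurable (`]0%R, 1%R[%classic `*` setT : set (plane R)) by exact: measurableX.
  apply/(measurable_restrictT _ mD).
  apply: (@measurable_funS _ _ _ _ setT) => //.
  apply: emeasurable_funM; first by apply: measurableT_comp; [exact: EFin_measurable|exact: measurable_fst].
  exact: measurableT_comp mF mP.
have := measurable_fun_fubini_tonelli_G (m1 := mu) _ mK K0.
apply: eq_measurable_fun => s _; rewrite /fubini_G [in RHS]integral_mkcond.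
apply: eq_integral => r _; rewrite /K !patchE.
have [/set_mem/= r01|/negP r01] := boolP (r \in `]0%R, 1%R[%classic).
  by rewrite mem_set.
by rewrite memNset// => -[/= h _]; apply: r01; rewrite inE.
Qed.

(** In the coordinates (r, t) of [cone] the triangle is 0 < t < r < 1 and the Jacobian
    is constant; the further substitution t = r s turns the triangle into a square
    and brings the weight r. *)
Lemma cone_integral T (F : plane R -> \bar R) :
  measurable_fun setT F -> (forall x, 0 <= F x) ->
  \int[area]_(x in interior_of T) F x = `|det2 T|%:E *
    \int[mu]_(s in `]0%R, 1%R[) \int[mu]_(r in `]0%R, 1%R[)
      (r%:E * F (vertA T + r *: (side_path (vertB T, vertC T) s - vertA T))%R).
Proof.
move=> mF F0.
have mT := measurable_interior T.
pose FT := F \_ (interior_of T).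
have FT0 x : 0 <= FT x by rewrite /FT patchE; case: ifP.
have mFT : measurable_fun setT FT.
  by apply/(measurable_restrictT _ mT); exact: measurable_funS mF.
rewrite integral_mkcond -/FT.
pose e := vertA T; pose u := (vertB T - vertA T)%R; pose v := (vertC T - vertB T)%R.
rewrite (@integral_affine_plane _ FT u.1 v.1 u.2 v.2 e.1 e.2)//; last first.
  apply: contra_neq (det2_neq0 T); rewrite /det2 /u /v !coordE.
  by move=> h; rewrite -h; ring.
congr (_ * _).
  congr (`| _ |%:E); rewrite /det2 /u /v !coordE.
  by ring.
have cE (r t : R) : (u.1 * r + v.1 * t + e.1, u.2 * r + v.2 * t + e.2)%R = cone T r t.
  by apply: eq_plane; rewrite !coordE /=; ring.
rewrite fubini_tonelli1//; last exact: measurableT_comp mFT (measurable_affine_plane _ _ _ _ _ _).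
rewrite /fubini_F/=.
have mc (h : R * R -> R) : continuous h ->
    measurable_fun setT ((fun z => cone T z.1 (h z)) : plane R -> plane R).
  move=> ch; apply/measurable_fun_pairP; split => /=;
    apply: continuous_measurable_plane => z; apply: cvgD => //=;
    (try by apply: cvgMl; exact: ch); apply: cvgD;
    (try exact: cvg_cst); by apply: cvgMl; exact: cvg_fst.
pose K := (fun z : plane R => z.1%:E * FT (cone T z.1 (z.1 * z.2)%R)) \_ (`]0%R, 1%R[ `*` setT).
have K0 z : 0 <= K z.
  rewrite /K patchE; case: ifPn => // /set_mem[/=]; rewrite in_itv/= => /andP[z0 _] _.
  by rewrite mule_ge0// lee_fin ltW.
have mK : measurable_fun setT K.
  have mD : measurable (`]0%R, 1%R[%classic `*` setT : set (plane R)) by exact: measurableX.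
  apply/(measurable_restrictT _ mD).
  apply: (@measurable_funS _ _ _ _ setT) => //.
  apply: emeasurable_funM; first by apply: measurableT_comp; [exact: EFin_measurable|exact: measurable_fst].
  apply: (measurableT_comp mFT); apply: mc => z.
  by apply: cvgM; [exact: cvg_fst|exact: cvg_snd].
transitivity (\int[mu]_r \int[mu]_s K (r, s)).
  apply: eq_integral => r _; under eq_integral => t _ do rewrite cE.
  have [r01|r01] := boolP (0 < r < 1)%R; last first.
    transitivity (0 : \bar R); last apply/esym; apply: integral0_eq => t _.
      rewrite /FT patchE memNset// interior_cone => -[t0 tr r1].
      by move/negP: r01; apply; apply/andP; split; lra.
    by rewrite /K patchE memNset// => -[/=]; rewrite in_itv/= => h; rewrite h in r01.
  have r0 : (0 < r)%R by case/andP: r01.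
  rewrite (@integral_affine _ (fun t => FT (cone T r t)) r 0%R)//; last 2 first.
  - apply: (measurableT_comp mFT); apply/measurable_fun_pairP; split => /=;
    apply: continuous_measurable_fun => z; apply: cvgD => //=; 
    by [exact: cvg_cst|apply: cvgMl; exact: cvg_id].
  - by rewrite gt_eqF.
  rewrite gtr0_norm// -ge0_integralZl//; last 2 first.
  - apply: (measurableT_comp mFT); apply/measurable_fun_pairP; split => /=;
    apply: continuous_measurable_fun => z; apply: cvgD => //=; 
      (try exact: cvg_cst); apply: cvgMl; apply: cvgD; (try exact: cvg_cst);
    by apply: cvgMr; exact: cvg_id.
  - by rewrite lee_fin ltW.
  apply: eq_integral => s _; rewrite /K patchE mem_set; last by split => //=; rewrite in_itv.
  by rewrite /= addr0.
rewrite (fubini_tonelli (m1 := mu) (m2 := mu) _ mK K0) [in RHS]integral_mkcond.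
apply: eq_integral => s _; rewrite patchE.
have [|/negP s01] := boolP (s \in `]0%R, 1%R[%classic).
  move=> /set_mem/=; rewrite in_itv/= => /andP[s0 s1].
  rewrite [in RHS]integral_mkcond; apply: eq_integral => r _.
  rewrite /K !patchE; have [/set_mem/= r01|/negP r01] := boolP (r \in `]0%R, 1%R[%classic); last first.
    by rewrite memNset// => -[/= h _]; apply: r01; rewrite inE.
  rewrite mem_set; last by split.
  move: r01; rewrite in_itv/= => /andP[r0 r1].
  rewrite /FT patchE mem_set.
    congr (_ * F _); rewrite /cone /side_path/=.
    by apply: eq_plane; rewrite !coordE; ring.
  apply/interior_cone; split => //; first exact: mulr_gt0.
  by rewrite gtr_pMr.
rewrite integral0_eq// => r _; rewrite /K patchE.
case: ifPn => // /set_mem[/=]; rewrite in_itv/= => /andP[r0 r1] _.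
rewrite /FT patchE memNset ?mule0// interior_cone => -[rs0 rsr _].
apply: s01; rewrite inE/= in_itv/=; apply/andP; split.
  by rewrite -(pmulr_rgt0 _ r0).
by rewrite -(gtr_pMr _ r0).
Qed.

End Cone.

(** * Smooth functions: directional derivatives and affine changes of variables *)

Section Calculus.
Context {R : realType}.
Implicit Types (f g : R * R -> R) (x v : R * R).

Lemma is_derive_lim (V : normedModType R) (f : V -> R) (a v : V) (l : R) :
  (fun h : R => h^-1 *: (f (h *: v + a) - f a)) @ 0^' --> l -> is_derive a v f l.
Proof.
move=> h; apply: DeriveDef; first by apply/cvg_ex; exists l.
exact: cvg_lim h.
Qed.

Lemma is_derive_line f x v (t l : R) :
  is_derive (x + t *: v) v f l -> is_derive t 1 (fun s : R => f (x + s *: v)) l.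
Proof.
move=> [df <-]; apply: is_derive_lim.
rewrite (_ : (fun h : R => _) = (fun h => h^-1 *: ((f \o shift (x + t *: v)) (h *: v) - f (x + t *: v)))).
  exact: df.
apply/funext => h /=; congr (_ *: (f _ - _)).
by rewrite -[h%:A]/(h * 1) mulr1 scalerDl addrCA.
Qed.

Lemma line_MVT f x v (s : R) :
  (forall y, derivable f y v) ->
  exists2 c : R, `|c| <= `|s| & f (x + s *: v) - f x = s * 'D_v f (x + c *: v).
Proof.
move=> df; pose g (t : R) := f (x + t *: v).
have dg (t : R) : is_derive t 1 g ('D_v f (x + t *: v)).
  by apply: is_derive_line; exact: derivableP.
have cg : continuous g.
  by move=> t; apply: differentiable_continuous; apply/derivable1_diffP; have [] := dg t.
have g0 : g 0 = f x by rewrite /g scale0r addr0.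
have [s0|s0] := leP 0 s.
  have [//|c] := @MVT_segment _ g (fun t => 'D_v f (x + t *: v)) 0 s s0 (fun t _ => dg t).
    exact: continuous_subspaceT.
  rewrite in_itv/= => /andP[c0 cs]; rewrite g0 subr0 => gE.
  by exists c; [rewrite !ger0_norm|rewrite mulrC -gE].
have [|c] := @MVT_segment _ g (fun t => 'D_v f (x + t *: v)) s 0 (ltW s0) (fun t _ => dg t).
  exact: continuous_subspaceT.
rewrite in_itv/= => /andP[sc c0]; rewrite g0 sub0r => gE.
exists c; first by rewrite !ler0_norm ?lerN2// ltW.
by rewrite -/(g s) -[LHS]opprB gE; ring.
Qed.

(** The increment from [x] to [x + h v] is a horizontal step after a vertical one; the
    mean value theorem on each step gives values of the partial derivatives at
    points that tend to [x]. *)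
Lemma is_derive_C1 f x v :
  (forall y, derivable f y e1 /\ derivable f y e2) ->
  {for x, continuous ('D_e1 f)} -> {for x, continuous ('D_e2 f)} ->
  is_derive x v f (v.1 * 'D_e1 f x + v.2 * 'D_e2 f x).
Proof.
move=> df c1 c2; apply: is_derive_lim; apply/cvgrPdist_le => /= eps eps0.
pose K := `|v.1| + `|v.2| + 1.
have K0 : 0 < K by rewrite /K ltr_wpDl// addr_ge0.
have e0 : 0 < eps / K by rewrite divr_gt0.
move: c1 => /cvgrPdist_le/(_ _ e0)/nbhs_ballP[d1 /= d10 D1].
move: c2 => /cvgrPdist_le/(_ _ e0)/nbhs_ballP[d2 /= d20 D2].
pose d := Num.min d1 d2 / K.
have dd : 0 < d by rewrite divr_gt0// lt_min d10 d20.
near=> h.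
have h0 : h != 0 by near: h; exact: nbhs_dnbhs_neq.
have hd : `|h| < d by near: h; exact: dnbhs0_lt.
have hK : `|h| * K < Num.min d1 d2 by rewrite -ltr_pdivlMr.
have [a ha fa] := @line_MVT f (x + (h * v.2) *: e2) e1 (h * v.1) (fun y => (df y).1).
have [b hb fb] := @line_MVT f x e2 (h * v.2) (fun y => (df y).2).
have -> : f (h *: v + x) - f x = (h * v.1) * 'D_e1 f (x + (h * v.2) *: e2 + a *: e1) +
    (h * v.2) * 'D_e2 f (x + b *: e2).
  rewrite -fa -fb addrA subrK; congr (f _ - _).
  by apply: eq_plane; rewrite !coordE /=; ring.
have hv1 : `|h * v.1| < Num.min d1 d2.
  rewrite (le_lt_trans _ hK)// normrM ler_wpM2l// /K.
  by have := normr_ge0 v.2; lra.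
have hv2 : `|h * v.2| < Num.min d1 d2.
  rewrite (le_lt_trans _ hK)// normrM ler_wpM2l// /K.
  by have := normr_ge0 v.1; lra.
have B1 : `|'D_e1 f x - 'D_e1 f (x + (h * v.2) *: e2 + a *: e1)| <= eps / K.
  apply: D1; move: hv1 hv2; rewrite !lt_min => /andP[h1 _] /andP[h2 _].
  split; rewrite /ball/= /GRing.scale/=.
    by rewrite (_ : _ - _ = - a); [rewrite normrN (le_lt_trans ha)|ring].
  by rewrite (_ : _ - _ = - (h * v.2)); [rewrite normrN|ring].
have B2 : `|'D_e2 f x - 'D_e2 f (x + b *: e2)| <= eps / K.
  apply: D2; move: hv2; rewrite !lt_min => /andP[_ h2].
  split; rewrite /ball/= /GRing.scale/=.
    by rewrite (_ : _ - _ = 0); [rewrite normr0|ring].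
  by rewrite (_ : _ - _ = - b); [rewrite normrN (le_lt_trans hb)|ring].
set A1 := 'D_e1 f (x + _ + _) in B1 *; set A2 := 'D_e2 f (x + _) in B2 *.
have -> : h^-1 *: (h * v.1 * A1 + h * v.2 * A2) = v.1 * A1 + v.2 * A2.
  by rewrite -[LHS]/(h^-1 * _); field.
rewrite (_ : _ - _ = v.1 * ('D_e1 f x - A1) + v.2 * ('D_e2 f x - A2)); last by ring.
rewrite (le_trans (ler_normD _ _))// !normrM.
apply: (@le_trans _ _ ((`|v.1| + `|v.2|) * (eps / K))).
  by rewrite mulrDl lerD// ler_wpM2l.
by rewrite mulrA ler_pdivrMr// mulrC ler_wpM2l ?ltW// /K; lra.
Unshelve. all: by end_near.
Qed.

Lemma smooth_continuous f : smooth f -> continuous f.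
Proof. by move=> /(_ 0%N). Qed.

Lemma smooth_derivable f x : smooth f -> derivable f x e1 /\ derivable f x e2.
Proof. by move=> /(_ 1%N)[]. Qed.

Lemma smooth_D1 f : smooth f -> smooth ('D_e1 f).
Proof. by move=> sf k; have [] := sf k.+1. Qed.

Lemma smooth_D2 f : smooth f -> smooth ('D_e2 f).
Proof. by move=> sf k; have [] := sf k.+1. Qed.

Lemma smooth_is_derive f x v : smooth f ->
  is_derive x v f (v.1 * 'D_e1 f x + v.2 * 'D_e2 f x).
Proof.
move=> sf; apply: is_derive_C1 => [y||]; first exact: smooth_derivable.
  exact/smooth_continuous/smooth_D1.
exact/smooth_continuous/smooth_D2.
Qed.

Lemma smooth_cst (c : R) : smooth (fun=> c).
Proof.
have D0 (v : R * R) (b : R) : 'D_v (fun=> b) = (fun=> 0) :> (R * R -> R).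
  by apply/funext => x; exact: derive_cst.
move=> k; elim: k c => [|k IH] c /=; first by move=> x; exact: cvg_cst.
by split; rewrite ?D0// => x; split; exact: derivable_cst.
Qed.

Lemma Ck_linear k f g (a b : R) : Ck k f -> Ck k g -> Ck k (fun x => a * f x + b * g x).
Proof.
elim: k f g => [|k IH] f g /=.
  by move=> cf cg x; apply: cvgD; apply: cvgMr; [exact: cf|exact: cg].
move=> [df f1 f2] [dg g1 g2].
have D v x : derivable f x v -> derivable g x v ->
    is_derive x v (fun x => a * f x + b * g x) (a * 'D_v f x + b * 'D_v g x).
  move=> /derivableP dfx /derivableP dgx.
  exact: (@is_deriveD _ _ _ (a \*: f) (b \*: g)).
split=> [x||].
- by split; apply: ex_derive; apply: D; [exact: (df x).1|exact: (dg x).1|exact: (df x).2|exact: (dg x).2].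
- rewrite (_ : 'D_e1 _ = fun x => a * 'D_e1 f x + b * 'D_e1 g x); first exact: IH.
  by apply/funext => x; apply: derive_val; apply: D; [exact: (df x).1|exact: (dg x).1].
- rewrite (_ : 'D_e2 _ = fun x => a * 'D_e2 f x + b * 'D_e2 g x); first exact: IH.
  by apply/funext => x; apply: derive_val; apply: D; [exact: (df x).2|exact: (dg x).2].
Qed.

Section Affine.
Variables (p u w : R * R).

Definition affine x : R * R := p + x.1 *: u + x.2 *: w.

Lemma continuous_affine : continuous affine.
Proof.
move=> x; apply: cvgD; first apply: cvgD; first exact: cvg_cst.
  by apply: cvgZl; exact: cvg_fst.
by apply: cvgZl; exact: cvg_snd.
Qed.

Lemma is_derive_affine1 f x (l : R) :
  is_derive (affine x) u f l -> is_derive x e1 (f \o affine) l.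
Proof.
move=> [df <-]; apply: is_derive_lim.
rewrite (_ : (fun h : R => _) = (fun h => h^-1 *: ((f \o shift (affine x)) (h *: u) - f (affine x)))).
  exact: df.
apply/funext => h /=; congr (_ *: (f _ - _)).
by rewrite /affine; apply: eq_plane; rewrite !coordE /=; ring.
Qed.

Lemma is_derive_affine2 f x (l : R) :
  is_derive (affine x) w f l -> is_derive x e2 (f \o affine) l.
Proof.
move=> [df <-]; apply: is_derive_lim.
rewrite (_ : (fun h : R => _) = (fun h => h^-1 *: ((f \o shift (affine x)) (h *: w) - f (affine x)))).
  exact: df.
apply/funext => h /=; congr (_ *: (f _ - _)).
by rewrite /affine; apply: eq_plane; rewrite !coordE /=; ring.
Qed.

Lemma D1_affine f x : smooth f ->
  is_derive x e1 (f \o affine) (u.1 * 'D_e1 f (affine x) + u.2 * 'D_e2 f (affine x)).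
Proof. by move=> sf; apply: is_derive_affine1; exact: smooth_is_derive. Qed.

Lemma D2_affine f x : smooth f ->
  is_derive x e2 (f \o affine) (w.1 * 'D_e1 f (affine x) + w.2 * 'D_e2 f (affine x)).
Proof. by move=> sf; apply: is_derive_affine2; exact: smooth_is_derive. Qed.

(** By the chain rule the partial derivatives of the composite are linear combinations
    of partial derivatives of [f] composed with the same map, so the order of
    differentiation can be raised by induction. *)
Lemma smooth_affine f : smooth f -> smooth (f \o affine).
Proof.
move=> sf k; elim: k f sf => [|k IH] f sf /=.
  move=> x; apply: continuous_comp; first exact: continuous_affine.
  exact: smooth_continuous.
split=> [x||].
- by split; apply: ex_derive; [exact: D1_affine|exact: D2_affine].
- rewrite (_ : 'D_e1 _ = fun x => u.1 * ('D_e1 f \o affine) x + u.2 * ('D_e2 f \o affine) x).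
    by apply: Ck_linear; apply: IH; [exact: smooth_D1|exact: smooth_D2].
  by apply/funext => x; apply: derive_val; exact: D1_affine.
- rewrite (_ : 'D_e2 _ = fun x => w.1 * ('D_e1 f \o affine) x + w.2 * ('D_e2 f \o affine) x).
    by apply: Ck_linear; apply: IH; [exact: smooth_D1|exact: smooth_D2].
  by apply/funext => x; apply: derive_val; exact: D2_affine.
Qed.

End Affine.

End Calculus.

(** * Integrals of a smooth function over a triangle and its sides *)

Section Energies.
Context {R : realType}.
Local Notation mu := (@lebesgue_measure R).
Implicit Types (T : triangle R) (f F : R * R -> R).

Lemma FTC2_everywhere (F f : R -> R) (a b : R) : a < b ->
  (forall x : R, is_derive x 1 F (f x)) -> continuous f ->
  (\int[mu]_(x in `[a, b]) (f x)%:E = (F b - F a)%:E)%E.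
Proof.
move=> ab dF cf.
have cF : continuous F.
  by move=> t; apply: differentiable_continuous; apply/derivable1_diffP; have [] := dF t.
rewrite (continuous_FTC2 (f := f) (F := F)) ?EFinB//.
- exact: continuous_subspaceT.
- split; first by move=> x _; have [] := dF x.
  + by apply: cvg_at_right_filter; exact: cF.
  + by apply: cvg_at_left_filter; exact: cF.
- by move=> x _; rewrite derive1E; exact: derive_val.
Qed.

Lemma continuous_integrable_unit (phi : R -> R) : continuous phi ->
  mu.-integrable `[0, 1] (EFin \o phi).
Proof.
move=> cphi; apply: continuous_compact_integrable; first exact: segment_compact.
exact: continuous_subspaceT.
Qed.

Lemma area_interior T : area (interior_of T) = (`|det2 T| / 2)%:E.
Proof.
have dF (x : R) : is_derive x 1 (fun r : R => r ^+ 2 / 2) x.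
  apply: is_derive_eq.
  rewrite /GRing.scale/=. by field.
rewrite -[LHS]mul1e -(integral_cst _ (measurable_interior T)) (@cone_integral _ _ (cst 1%E))//.
under eq_integral => s _.
  under eq_integral do rewrite /= mule1.
  rewrite -(integral_itv_bndoo true false); last exact: EFin_measurable.
  rewrite (FTC2_everywhere ltr01 dF)//; first over.
  by move=> x; exact: cvg_id.
rewrite integral_cst//= lebesgue_measure_itv/= lte_fin ltr01 -!EFinD -!EFinM.
by congr _%:E; field.
Qed.

Lemma continuous_bounded_interior T F : continuous F ->
  [bounded F x | x in interior_of T].
Proof.
move=> cF; pose Q : set (R * R) := `[0, 1]%classic `*` `[0, 1]%classic.
have cQ : compact Q by apply: compact_setX; exact: segment_compact.
pose G := F \o affine (vertA T) (vertB T - vertA T) (vertC T - vertB T).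
have cG : continuous G.
  by move=> x; apply: continuous_comp; [exact: continuous_affine|exact: cF].
have : bounded_set (G @` Q).
  by apply: compact_bounded; apply: continuous_compact cQ; exact: continuous_subspaceT.
rewrite /bounded_set /bounded_near; apply: filterS => M h x Tx /=; apply: h.
exists (baryB T x + baryC T x, baryC T x) => /=.
  move/interior_baryE : Tx => -[c0 b0 bc1].
  by split; rewrite /= in_itv/=; apply/andP; split; lra.
by rewrite /G/=; congr F; rewrite -[RHS](cone_bary T x).
Qed.

Lemma continuous_integrable_interior T F : continuous F ->
  area.-integrable (interior_of T : set (plane R)) (EFin \o F).
Proof.
move=> cF; apply: measurable_bounded_integrable.
- exact: measurable_interior.
- by have := area_interior T => /= ->; rewrite ltry.
- by apply: (@measurable_funS _ _ _ _ setT) => //; exact: continuous_measurable_plane.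
- exact: continuous_bounded_interior.
Qed.

Lemma integral_interior_fin T F : continuous F ->
  (\int[area]_(x in interior_of T) (F x)%:E)%E =
  (\int[area]_(x in interior_of T) F x)%:E.
Proof.
move=> cF; rewrite /Rintegral fineK//; apply: integrable_fin_num.
  exact: measurable_interior.
exact: continuous_integrable_interior.
Qed.

Definition mass T f : R := \int[area]_(x in interior_of T) (f x ^+ 2).
Definition energy T f : R := \int[area]_(x in interior_of T) norm2sq (grad f x).
Definition side_mass f (s : (R * R) * (R * R)) : R :=
  \int[mu]_(t in `[0, 1]) (f (side_path s t) ^+ 2).

Lemma continuousX2 (U : topologicalType) (g : U -> R) :
  continuous g -> continuous (fun x => g x ^+ 2).
Proof. by move=> cg x; apply: cvgM; exact: cg. Qed.

Lemma continuous_energy f : smooth f -> continuous (fun x => norm2sq (grad f x)).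
Proof.
move=> sf x; apply: cvgD.
  exact: (continuousX2 (smooth_continuous (smooth_D1 sf))).
exact: (continuousX2 (smooth_continuous (smooth_D2 sf))).
Qed.

Lemma norm2sq_ge0 (x : R * R) : 0 <= norm2sq x.
Proof. by rewrite addr_ge0 ?sqr_ge0. Qed.

Lemma energy_ge0 T f : 0 <= energy T f.
Proof. by apply: Rintegral_ge0 => x _; exact: norm2sq_ge0. Qed.

Lemma side_mass_ge0 f s : 0 <= side_mass f s.
Proof. by apply: Rintegral_ge0 => x _; exact: sqr_ge0. Qed.

Lemma continuous_side_path s : continuous (@side_path R s).
Proof.
move=> t; apply: cvgD; first exact: cvg_cst.
by apply: cvgZl; exact: cvg_id.
Qed.

Lemma side_massE f s : continuous f ->
  (\int[mu]_(t in `[0%R, 1%R]) (f (side_path s t) ^+ 2)%:E)%E = (side_mass f s)%:E.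
Proof.
move=> cf; rewrite /side_mass /Rintegral fineK//; apply: integrable_fin_num => //.
apply: continuous_integrable_unit; apply: continuousX2 => t.
by apply: continuous_comp; [exact: continuous_side_path|exact: cf].
Qed.

Lemma boundary_integralE T f : continuous f ->
  boundary_integral T (fun x => f x ^+ 2) =
  (\sum_(s <- sides T) Defs.edist s.1 s.2 * side_mass f s)%:E.
Proof.
move=> cf; rewrite /boundary_integral -sumEFin.
by apply: eq_bigr => s _; rewrite side_massE// -EFinM.
Qed.

Lemma CauchySchwarz2 (w z : R * R) :
  (w.1 * z.1 + w.2 * z.2) ^+ 2 <= norm2sq w * norm2sq z.
Proof.
rewrite -subr_ge0 (_ : _ - _ = (w.1 * z.2 - w.2 * z.1) ^+ 2) ?sqr_ge0//.
by rewrite /norm2sq; ring.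
Qed.

(** Write [f (a + w) ^+ 2] as the integral of the derivative of [(r f) ^+ 2] along the
    ray.  The factor [r ^+ 2] removes the contribution of the end [a] and leaves the
    weight [r] of [cone_integral]; the cross term is split by the arithmetic-geometric
    inequality with parameter [eps]. *)
Lemma ray_trace f (a w : R * R) (eps K : R) : smooth f -> 0 < eps -> norm2sq w <= K ->
  (((f (a + w)) ^+ 2)%:E <= \int[mu]_(r in `]0%R, 1%R[)
    (r * ((2 + eps^-1) * f (a + r *: w) ^+ 2
            + eps * K * norm2sq (grad f (a + r *: w))))%:E)%E.
Proof.
move=> sf eps0 wK.
pose g (r : R) := f (a + r *: w).
pose k (r : R) := w.1 * 'D_e1 f (a + r *: w) + w.2 * 'D_e2 f (a + r *: w).
have dg (r : R) : is_derive r 1 g (k r).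
  by apply: is_derive_line; exact: smooth_is_derive.
have cray (h : R * R -> R) : continuous h -> continuous (fun r : R => h (a + r *: w)).
  move=> ch; rewrite (_ : (fun r : R => _) = h \o (fun r : R => a + r *: w))// => r.
  apply: continuous_comp; last exact: ch.
  by apply: cvgD; [exact: cvg_cst|apply: cvgZl; exact: cvg_id].
have cg : continuous g by apply: cray; exact: smooth_continuous.
have ck : continuous k.
  move=> r; apply: cvgD; apply: cvgMr.
    exact: (cray _ (smooth_continuous (smooth_D1 sf))).
  exact: (cray _ (smooth_continuous (smooth_D2 sf))).
pose F (r : R) := (r * g r) ^+ 2.
pose F' (r : R) := 2 * (r * g r) * (g r + r * k r).
have dF (r : R) : is_derive r 1 F (F' r).
  rewrite /F /F'.
  have := dg r => ?.
  apply: is_derive_eq; rewrite /GRing.scale/=; ring.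
have cF' : continuous F'.
  move=> r; apply: cvgM.
    by apply: cvgMr; apply: cvgM; [exact: cvg_id|exact: cg].
  by apply: cvgD; [exact: cg|apply: cvgM; [exact: cvg_id|exact: ck]].
pose G (r : R) := r * ((2 + eps^-1) * f (a + r *: w) ^+ 2
            + eps * K * norm2sq (grad f (a + r *: w))).
have cG : continuous G.
  move=> r; apply: cvgM; first exact: cvg_id.
  apply: cvgD; apply: cvgMr; first exact: (continuousX2 cg).
  exact: (cray _ (continuous_energy sf)).
have -> : (f (a + w) ^+ 2)%:E = (F 1 - F 0)%:E.
  by rewrite /F /g mul1r mul0r expr0n subr0 scale1r.
rewrite -(FTC2_everywhere ltr01 dF cF') -(integral_itv_bndoo true false); last first.
  by apply/measurable_EFinP; apply: measurable_funS (continuous_measurable_fun cG).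
apply: le_integral => //; try exact: continuous_integrable_unit.
move=> r; rewrite inE/= in_itv/= => /andP[r0 r1]; rewrite lee_fin.
rewrite /F' /G -/(g r).
have kE : k r ^+ 2 <= K * norm2sq (grad f (a + r *: w)).
  apply: (le_trans (CauchySchwarz2 w (grad f (a + r *: w)))).
  by rewrite ler_wpM2r// norm2sq_ge0.
set E := norm2sq _ in kE *; set y := g r; set z := k r in kE *.
rewrite (_ : 2 * (r * y) * (y + r * z) = r * (2 * y ^+ 2 + 2 * y * (r * z))); last by ring.
apply: ler_wpM2l => //.
rewrite [leRHS](_ : _ = 2 * y ^+ 2 + (eps^-1 * y ^+ 2 + eps * (K * E))) ?lerD2l; last by ring.
have h1 : 2 * y * (r * z) <= eps^-1 * y ^+ 2 + eps * (r * z) ^+ 2.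
  rewrite -subr_ge0 (_ : _ - _ = eps^-1 * (y - eps * (r * z)) ^+ 2).
    by rewrite mulr_ge0 ?sqr_ge0// invr_ge0 ltW.
  by field; rewrite gt_eqF.
apply: (le_trans h1); rewrite lerD2l; apply: ler_wpM2l; first exact: ltW.
apply: le_trans kE; rewrite exprMn ler_piMl ?sqr_ge0//.
by rewrite expr_le1.
Qed.

(** Integration of [ray_trace] over all rays from the vertex A.  For a constant [f] and
    [eps] large this tends to an equality: the constant 2 is sharp, which the
    comparison of triangles relies on. *)
Lemma trace_ineq T f (eps K : R) : smooth f -> 0 < eps ->
  (forall s, 0 <= s <= 1 -> norm2sq (side_path (vertB T, vertC T) s - vertA T) <= K) ->
  `|det2 T| * side_mass f (vertB T, vertC T) <=
    (2 + eps^-1) * mass T f + eps * K * energy T f.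
Proof.
move=> sf eps0 hK.
have cf := smooth_continuous sf.
have K0 : 0 <= K by apply: le_trans (hK 0 _); rewrite ?norm2sq_ge0// lexx ler01.
pose G x := (2 + eps^-1) * f x ^+ 2 + eps * K * norm2sq (grad f x).
have G0 x : 0 <= G x.
  rewrite addr_ge0// mulr_ge0 ?norm2sq_ge0 ?sqr_ge0//.
    by rewrite addr_ge0// invr_ge0 ltW.
  by rewrite mulr_ge0// ltW.
have cf2 := continuousX2 cf; have ce := continuous_energy sf.
have cG : continuous G.
  by move=> x; apply: cvgD; apply: cvgMr; [exact: cf2|exact: ce].
have mG := continuous_measurable_plane cG.
have -> : (2 + eps^-1) * mass T f + eps * K * energy T f =
    \int[area]_(x in interior_of T) G x.
  have mT := measurable_interior T.
  rewrite RintegralD//; first last.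
  - by apply: continuous_integrable_interior => x; apply: cvgMr; exact: ce.
  - by apply: continuous_integrable_interior => x; apply: cvgMr; exact: cf2.
  rewrite RintegralZl//; last exact: continuous_integrable_interior.
  by rewrite RintegralZl//; exact: continuous_integrable_interior.
rewrite -lee_fin -integral_interior_fin// cone_integral//; last first.
  exact/measurable_EFinP.
rewrite EFinM lee_wpmul2l// -side_massE//.
have cs : continuous (fun s : R => f (side_path (vertB T, vertC T) s) ^+ 2).
  apply: continuousX2 => t.
  by apply: continuous_comp; [exact: continuous_side_path|exact: cf].
rewrite (integral_itv_bndoo true false); last first.
  by apply/measurable_EFinP; apply: measurable_funS (continuous_measurable_fun cs).
apply: ge0_le_integral => //.
- by move=> s _; rewrite lee_fin sqr_ge0.
- by apply/measurable_EFinP; apply: measurable_funS (continuous_measurable_fun cs).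
- have mC := @measurable_cone _ T (EFin \o G) ((measurable_EFinP _ _).2 mG)
    (fun x => G0 x : (0 <= (EFin \o G) x)%E).
  exact: measurable_funS mC.
- move=> s /=; rewrite in_itv/= => /andP[s0 s1].
  rewrite [leLHS](_ : _ = (f (vertA T + (side_path (vertB T, vertC T) s - vertA T)) ^+ 2)%:E);
    last by rewrite addrC subrK.
  apply: (le_trans (@ray_trace f (vertA T) (side_path (vertB T, vertC T) s - vertA T) eps K sf eps0 _)).
    by apply: hK; rewrite !ltW.
  rewrite le_eqVlt; apply/orP; left; apply/eqP.
  by apply: eq_integral => r _; rewrite -EFinM.
Qed.

End Energies.

(** * The gradient of a smooth function is its distributional gradient *)

Section WeakGradient.
Context {R : realType}.
Local Notation mu := (@lebesgue_measure R).
Implicit Types (T : triangle R) (f F : R * R -> R).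

Lemma integral_line_derivative (H h : R * R -> R) (p v : R * R) (M : R) :
  0 < M -> continuous h -> (forall x, is_derive x v H (h x)) ->
  (forall t : R, M <= `|t| -> H (p + t *: v) = 0 /\ h (p + t *: v) = 0) ->
  (\int[mu]_t (h (p + t *: v))%:E = 0)%E.
Proof.
move=> M0 ch dH hM.
transitivity (\int[mu]_(t in `[(- M)%R, M]) (h (p + t *: v))%:E)%E.
  rewrite [RHS]integral_mkcond; apply: eq_integral => t _; rewrite patchE.
  case: ifPn => // /negP; rewrite inE/= in_itv/= => tM.
  by rewrite (hM t _).2// leNgt ltr_norml; apply/negP => /andP[? ?]; apply: tM; apply/andP; split; lra.
have dl (t : R) : is_derive t 1 (fun s : R => H (p + s *: v)) (h (p + t *: v)).
  exact: is_derive_line.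
have cl : continuous (fun t : R => h (p + t *: v)).
  rewrite (_ : (fun t : R => _) = h \o (fun t : R => p + t *: v))// => t.
  apply: continuous_comp; last exact: ch.
  by apply: cvgD; [exact: cvg_cst|apply: cvgZl; exact: cvg_id].
rewrite (FTC2_everywhere _ dl cl); last by lra.
by rewrite !(hM _ _).1 ?subrr// ?normrN gtr0_norm.
Qed.

Lemma interior_bounded T : exists2 M : R, 0 < M &
  forall x, interior_of T x -> `|x.1| < M /\ `|x.2| < M.
Proof.
have [M1 [_ h1]] := continuous_bounded_interior T (fun x => @cvg_fst _ _ _ _ _).
have [M2 [_ h2]] := continuous_bounded_interior T (fun x => @cvg_snd _ _ _ _ _).
have m1 := ler_norm M1; have m2 := ler_norm M2.
have n1 := normr_ge0 M1; have n2 := normr_ge0 M2.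
exists (`|M1| + `|M2| + 2) => [|x Tx]; first lra.
have := h1 (`|M1| + 1) ltac:(lra) x Tx; have := h2 (`|M2| + 1) ltac:(lra) x Tx.
by rewrite /=; split; lra.
Qed.

(** Here [h] is a partial derivative of [H], both vanishing outside of the triangle.
    Integrating first along the direction of differentiation gives zero on each
    line. *)
Section DivergenceTheorem.
Variables (T : triangle R) (H h : R * R -> R).
Hypothesis ch : continuous h.
Hypothesis H0 : forall x, ~ interior_of T x -> H x = 0.
Hypothesis h0 : forall x, ~ interior_of T x -> h x = 0.

Let hE : h \_ (interior_of T) = h.
Proof. by apply/funext => x; rewrite patchE; case: ifPn => // /negP; rewrite inE => /h0 ->. Qed.

Let integral_interiorT :
  \int[area]_(x in interior_of T) h x = fine (\int[area]_x (h x)%:E)%E.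
Proof. by rewrite Rintegral_mkcond hE. Qed.

Let integrableT : area.-integrable (setT : set (plane R)) (EFin \o h).
Proof.
have := continuous_integrable_interior T ch.
rewrite integrable_mkcond; last exact: measurable_interior.
congr (_.-integrable _ _); apply/funext => x; rewrite -[in RHS]hE /= !patchE.
by case: ifP.
Qed.

Lemma integral_D1_eq0 : (forall x, is_derive x e1 H (h x)) ->
  \int[area]_(x in interior_of T) h x = 0.
Proof.
move=> dH; rewrite integral_interiorT -[in LHS]integral21_prod_meas1//.
have [M M0 TM] := interior_bounded T.
rewrite integral0_eq// => y _; rewrite /fubini_G.
have xE (t : R) : (t, y) = (0, y) + t *: (e1 : R * R).
  by apply: eq_plane; rewrite !coordE /=; ring.
under eq_integral => x _ do rewrite /= xE.
apply: (integral_line_derivative M0 ch dH) => t; rewrite -xE => tM.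
have nT : ~ interior_of T (t, y) by move=> /TM[/=]; rewrite ltNge tM.
by rewrite H0// h0.
Qed.

Lemma integral_D2_eq0 : (forall x, is_derive x e2 H (h x)) ->
  \int[area]_(x in interior_of T) h x = 0.
Proof.
move=> dH; rewrite integral_interiorT -[in LHS]integral12_prod_meas1//.
have [M M0 TM] := interior_bounded T.
rewrite integral0_eq// => y _; rewrite /fubini_F.
have xE (t : R) : (y, t) = (y, 0) + t *: (e2 : R * R).
  by apply: eq_plane; rewrite !coordE /=; ring.
under eq_integral => x _ do rewrite /= xE.
apply: (integral_line_derivative M0 ch dH) => t; rewrite -xE => tM.
have nT : ~ interior_of T (y, t) by move=> /TM[_ /=]; rewrite ltNge tM.
by rewrite H0// h0.
Qed.

End DivergenceTheorem.

Lemma smooth_weak_gradient T f : smooth f -> weak_gradient (interior_of T) f (grad f).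
Proof.
move=> sf phi [sphi _ supp].
have phi0 x : ~ interior_of T x -> phi x = 0.
  by move=> nTx; apply/eqP/negPn/negP => px; apply: nTx; apply: supp; exact: subset_closure.
have dphi0 v x : ~ interior_of T x -> 'D_v phi x = 0.
  move=> nTx; rewrite (@near_eq_derive _ _ _ _ (fun=> 0)) ?derive_cst//.
  have : open_nbhs x (~` closure [set y | phi y != 0]).
    by split; [apply: closed_openC; exact: closed_closure|move=> /supp].
  move=> /open_nbhs_nbhs; apply: filterS => y nsy; apply/eqP/negPn/negP => py.
  by apply: nsy; exact: subset_closure.
have cf := smooth_continuous sf; have cphi := smooth_continuous sphi.
have part (v : R * R) (Df Dphi : R * R -> R) :
    continuous Df -> continuous Dphi -> Dphi = 'D_v phi ->
    (forall x, is_derive x v f (Df x)) -> (forall x, is_derive x v phi (Dphi x)) ->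
    ((forall x, is_derive x v (f * phi) (f x *: Dphi x + phi x *: Df x)) ->
      \int[area]_(x in interior_of T) (f x *: Dphi x + phi x *: Df x) = 0) ->
    \int[area]_(x in interior_of T) (f x * Dphi x) =
    - \int[area]_(x in interior_of T) (Df x * phi x).
  move=> cDf cDphi _ df dphi int0; apply/eqP; rewrite -subr_eq0 opprK -RintegralD//.
  - have I0 := int0 (fun x => is_deriveM (df x) (dphi x)); rewrite -[eqbRHS]I0.
    by apply/eqP; apply: eq_Rintegral => x _; rewrite [Df x * _]mulrC.
  - exact: measurable_interior.
  - by apply: continuous_integrable_interior => x; apply: cvgM; [exact: cf|exact: cDphi].
  - by apply: continuous_integrable_interior => x; apply: cvgM; [exact: cDf|exact: cphi].
have prod0 x : ~ interior_of T x -> (f * phi) x = 0.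
  by move=> nTx; rewrite -[LHS]/(f x * phi x) phi0// mulr0.
have dprod0 v (Df : R * R -> R) x : ~ interior_of T x ->
    f x *: 'D_v phi x + phi x *: Df x = 0.
  by move=> nTx; rewrite phi0// dphi0// scaler0 scale0r addr0.
split.
- apply: (part e1) => //; try exact: smooth_continuous (smooth_D1 _).
  + by move=> x; apply: derivableP; exact: (smooth_derivable x sf).1.
  + by move=> x; apply: derivableP; exact: (smooth_derivable x sphi).1.
  + move=> /integral_D1_eq0; apply => // [x|x].
      by apply: cvgD; apply: cvgM; [exact: cf|exact: (smooth_continuous (smooth_D1 sphi))|
        exact: cphi|exact: (smooth_continuous (smooth_D1 sf))].
    exact: (dprod0 _ (fun z => (grad f z).1)).
- apply: (part e2) => //; try exact: smooth_continuous (smooth_D2 _).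
  + by move=> x; apply: derivableP; exact: (smooth_derivable x sf).2.
  + by move=> x; apply: derivableP; exact: (smooth_derivable x sphi).2.
  + move=> /integral_D2_eq0; apply => // [x|x].
      by apply: cvgD; apply: cvgM; [exact: cf|exact: (smooth_continuous (smooth_D2 sphi))|
        exact: cphi|exact: (smooth_continuous (smooth_D2 sf))].
    exact: (dprod0 _ (fun z => (grad f z).2)).
Qed.

End WeakGradient.

(** * Smooth functions determine the first Robin eigenvalue *)

Section Density.
Context {R : realType}.
Local Notation mu := (@lebesgue_measure R).
Implicit Types (T : triangle R) (f : R * R -> R).

Lemma young_sqr (a b eps : R) : 0 < eps ->
  a ^+ 2 <= (1 + eps) * b ^+ 2 + (1 + eps^-1) * (a - b) ^+ 2.
Proof.
move=> e0; rewrite -subr_ge0 (_ : _ - _ = eps^-1 * ((a - b) - eps * b) ^+ 2).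
  by rewrite mulr_ge0 ?sqr_ge0// invr_ge0 ltW.
by field; rewrite gt_eqF.
Qed.

Lemma young_norm2sq (a b : R * R) (eps : R) : 0 < eps ->
  norm2sq a <= (1 + eps) * norm2sq b + (1 + eps^-1) * norm2sq (a - b).
Proof.
move=> e0; have h1 := young_sqr a.1 b.1 e0; have h2 := young_sqr a.2 b.2 e0.
by rewrite /norm2sq !coordE !mulrDr; lra.
Qed.

(** Convergence in norm implies convergence of the norms, here for squared norms and
    with the triangle inequality in the weighted form of [young_sqr]; this form is
    linear in the squared norms, hence is obtained by integrating a pointwise
    inequality, over the triangle as well as over its sides. *)
Lemma young_cvg (a : nat -> R) (A : R) (e : nat -> \bar R) :
  0 <= A -> (forall n, 0 <= e n)%E -> e @ \oo --> 0%E ->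
  (forall n (eps : R), (0 < eps)%R -> (a n)%:E <= (1 + eps)%:E * A%:E + (1 + eps^-1)%:E * e n)%E ->
  (forall n (eps : R), (0 < eps)%R -> A%:E <= (1 + eps)%:E * (a n)%:E + (1 + eps^-1)%:E * e n)%E ->
  a @ \oo --> A.
Proof.
move=> A0 e0 ecvg h1 h2; apply/cvgrPdist_le => /= eta eta0.
pose eps := Num.min 1 (eta / (4 * (A + 1))).
have A1 : 0 < 4 * (A + 1) by lra.
have eps0 : 0 < eps by rewrite lt_min ltr01 divr_gt0.
have eps1 : eps <= 1 by rewrite ge_min lexx.
have epsA : eps * A <= eta / 4.
  have : eps <= eta / (4 * (A + 1)) by rewrite ge_min lexx orbT.
  rewrite ler_pdivlMr// => h; have := mulr_ge0 (ltW eps0) A0.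
  by move: h; rewrite mulrCA mulrDr mulr1; lra.
pose C := 1 + eps^-1.
have C0 : 0 < C by rewrite addr_gt0// invr_gt0.
have : \forall n \near \oo, (e n < (eta / 4 / C)%:E)%E.
  apply: (ecvg _ (@nbhs_open_ereal_lt R 0 (fun=> eta / 4 / C) _)).
  by rewrite !divr_gt0.
apply: filterS => n en.
have fe : e n \is a fin_num.
  by rewrite ge0_fin_numE// (lt_le_trans en)// leey.
have := h1 n _ eps0; have := h2 n _ eps0; move: en.
rewrite -(fineK fe) -!EFinM -!EFinD !lee_fin lte_fin ltr_pdivlMr// -/C.
set z := fine (e n); rewrite mulrC => zC i1 i2.
rewrite ler_norml; apply/andP; split; first by move: i2; rewrite mulrDl mul1r; lra.
have an : a n <= A + eta / 2 by move: i2; rewrite mulrDl mul1r; lra.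
have : eps * a n <= eps * A + eta / 2.
  apply: (le_trans (ler_wpM2l (ltW eps0) an)); rewrite mulrDr lerD2l.
  by rewrite ler_piMl//; lra.
by move: i1; rewrite mulrDl mul1r; lra.
Qed.

Lemma le_integral_combination d (X : measurableType d) (m : {measure set X -> \bar R})
    (D : set X) (P Q S : X -> R) (a b : R) :
  measurable D -> measurable_fun D P -> measurable_fun D Q -> measurable_fun D S ->
  0 <= a -> 0 <= b ->
  (forall x, 0 <= P x) -> (forall x, 0 <= Q x) -> (forall x, 0 <= S x) ->
  (forall x, P x <= a * Q x + b * S x) ->
  (\int[m]_(x in D) (P x)%:E <=
   a%:E * \int[m]_(x in D) (Q x)%:E + b%:E * \int[m]_(x in D) (S x)%:E)%E.
Proof.
move=> mD mP mQ mS a0 b0 P0 Q0 S0 PQS.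
rewrite -!ge0_integralZl_EFin//; first last.
- exact/measurable_EFinP.
- by move=> x _; rewrite lee_fin.
- exact/measurable_EFinP.
- by move=> x _; rewrite lee_fin.
rewrite -ge0_integralD//; first last.
- by apply: measurable_funeM; exact/measurable_EFinP.
- by move=> x _; rewrite mule_ge0// lee_fin.
- by apply: measurable_funeM; exact/measurable_EFinP.
- by move=> x _; rewrite mule_ge0// lee_fin.
apply: ge0_le_integral => //.
- by move=> x _; rewrite lee_fin.
- exact/measurable_EFinP.
- by apply: emeasurable_funD; apply: measurable_funeM; exact/measurable_EFinP.
- by move=> x _; rewrite -!EFinM -EFinD lee_fin.
Qed.

Lemma measurable_continuous_interior T f : continuous f ->
  measurable_fun (interior_of T : set (plane R)) f.
Proof. by move=> cf; apply: measurable_funS (continuous_measurable_plane cf). Qed.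

Definition bdry_mass T f : R := \sum_(s <- sides T) Defs.edist s.1 s.2 * side_mass f s.

Definition quotient (alpha : R) T f : R :=
  (energy T f + alpha * bdry_mass T f) / mass T f.

Lemma rayleigh_smooth alpha T f : smooth f ->
  rayleigh alpha T f (grad f) f = quotient alpha T f.
Proof.
by move=> sf; rewrite /rayleigh boundary_integralE//; exact: smooth_continuous.
Qed.

Lemma euclid_ge0 (p q : R * R) : 0 <= Defs.edist p q.
Proof. exact: sqrtr_ge0. Qed.

Lemma boundary_integral_ge0 T (P : R * R -> R) : (forall x, 0 <= P x) ->
  (0 <= boundary_integral T P)%E.
Proof.
move=> P0; apply: sume_ge0 => s _; rewrite mule_ge0 ?lee_fin ?euclid_ge0//.
by apply: integral_ge0 => t _; rewrite lee_fin.
Qed.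

Lemma measurable_side f s : continuous f ->
  measurable_fun (`[0, 1] : set (measurableTypeR R)) (fun t : R => f (side_path s t)).
Proof.
move=> cf; apply: (@measurable_funS _ _ _ _ setT) => //; apply: continuous_measurable_fun.
by move=> t; apply: continuous_comp; [exact: continuous_side_path|exact: cf].
Qed.

Lemma smooth_admissible alpha T f : smooth f -> 0 < mass T f ->
  [set r | exists u G g,
    [/\ H1 (interior_of T) u G, trace T u G g,
        ~ {ae area, forall x, interior_of T x -> u x = 0} &
        r = rayleigh alpha T u G g]] (quotient alpha T f).
Proof.
move=> sf m0; have cf := smooth_continuous sf.
have L2c (h : R * R -> R) : continuous h -> L2 (interior_of T) h.
  move=> ch; split; first exact: measurable_continuous_interior.
  by rewrite integral_interior_fin ?ltry//; exact: continuousX2.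
have mT := measurable_interior T.
exists f, (grad f), f; split; last by rewrite rayleigh_smooth.
- split; [exact: L2c| | |exact: smooth_weak_gradient].
    exact/L2c/smooth_continuous/smooth_D1.
  exact/L2c/smooth_continuous/smooth_D2.
- split.
    split=> [s _|]; first exact: measurable_side.
    by rewrite boundary_integralE// ltry.
  exists (fun=> f); split => //.
  + rewrite [X in X @ _](_ : _ = cst 0%E); first exact: cvg_cst.
    by apply/funext => n /=; apply: integral0_eq => x _; rewrite subrr expr0n.
  + rewrite [X in X @ _](_ : _ = cst 0%E); first exact: cvg_cst.
    apply/funext => n /=; apply: integral0_eq => x _.
    by rewrite subrr /norm2sq/= !expr0n addr0.
  + rewrite [X in X @ _](_ : _ = cst 0%E); first exact: cvg_cst.
    apply/funext => n /=; rewrite /boundary_integral big1// => s _.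
    by rewrite integral0_eq ?mule0// => t _; rewrite subrr expr0n.
- move=> ae0; move: m0; rewrite lt_neqAle => /andP[/eqP + _]; apply.
  rewrite /mass /Rintegral (ae_eq_integral (cst 0%E))//.
  + by rewrite integral0.
  + apply/measurable_EFinP; apply: measurable_continuous_interior; exact: continuousX2.
  + apply: negligibleS ae0 => x /=; apply: contra_not => h Tx.
    by rewrite h// expr0n.
Qed.

(** The approximating sequence that defines the trace converges in all three integrals
    of the quotient, and the denominator has a nonzero limit. *)
Lemma smooth_dense alpha T u G g :
  H1 (interior_of T) u G -> trace T u G g ->
  ~ {ae area, forall x, interior_of T x -> u x = 0} ->
  forall eps : R, 0 < eps -> exists f,
    [/\ smooth f, 0 < mass T f & `|rayleigh alpha T u G g - quotient alpha T f| <= eps].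
Proof.
move=> [[mu_ Lu] [mG1 LG1] [mG2 LG2] _] [[mg Lg] [f [sf cN cD cB]]] nz eps eps0.
have mT := measurable_interior T.
have cf n : continuous (f n) by exact: smooth_continuous.
have msq (h : plane R -> R) : measurable_fun (interior_of T : set (plane R)) h ->
    measurable_fun (interior_of T : set (plane R)) (fun x => h x ^+ 2).
  by move=> mh; exact: measurable_funX.
have mf n := measurable_continuous_interior (T := T) (cf n).
have finN : (\int[area]_(x in interior_of T) (u x ^+ 2)%:E)%E \is a fin_num.
  by rewrite ge0_fin_numE//; apply: integral_ge0 => x _; rewrite lee_fin sqr_ge0.
have NN : (fun n => mass T (f n)) @ \oo --> \int[area]_(x in interior_of T) (u x ^+ 2).
  apply: (young_cvg _ _ cN).
  - by apply: Rintegral_ge0 => x _; exact: sqr_ge0.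
  - by move=> n; apply: integral_ge0 => x _; rewrite lee_fin sqr_ge0.
  - move=> n e e0; rewrite /mass -(integral_interior_fin T (continuousX2 (cf n))).
    rewrite /Rintegral fineK//; apply: le_integral_combination => //;
      try (by move=> x; exact: sqr_ge0); try (by rewrite addr_ge0// ?invr_ge0 ltW).
    + exact: (msq _ (mf n)).
    + exact: (msq _ mu_).
    + exact: (msq _ (measurable_funB (mf n) mu_)).
    + by move=> x; exact: young_sqr.
  - move=> n e e0; rewrite /mass -(integral_interior_fin T (continuousX2 (cf n))).
    rewrite /Rintegral fineK//; apply: le_integral_combination => //;
      try (by move=> x; exact: sqr_ge0); try (by rewrite addr_ge0// ?invr_ge0 ltW).
    + exact: (msq _ mu_).
    + exact: (msq _ (mf n)).
    + exact: (msq _ (measurable_funB (mf n) mu_)).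
    + by move=> x; rewrite -[(f n x - u x) ^+ 2]sqrrN opprB; exact: young_sqr.
have mnorm (h : plane R -> R * R) :
   measurable_fun (interior_of T : set (plane R)) (fun x => (h x).1) ->
   measurable_fun (interior_of T : set (plane R)) (fun x => (h x).2) ->
   measurable_fun (interior_of T : set (plane R)) (fun x => norm2sq (h x)).
  by move=> h1 h2; apply: measurable_funD; [exact: (msq _ h1)|exact: (msq _ h2)].
have mgr n : measurable_fun (interior_of T : set (plane R)) (fun x => (grad (f n) x).1) /\
   measurable_fun (interior_of T : set (plane R)) (fun x => (grad (f n) x).2).
  by split; apply: measurable_continuous_interior; apply: smooth_continuous;
    [exact: smooth_D1|exact: smooth_D2].
have mgrB n : measurable_fun (interior_of T : set (plane R)) (fun x => norm2sq (grad (f n) x - G x)).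
  have [h1 h2] := mgr n.
  by apply: mnorm; apply: measurable_funB.
have finD : (\int[area]_(x in interior_of T) (norm2sq (G x))%:E)%E \is a fin_num.
  rewrite ge0_fin_numE; last by apply: integral_ge0 => x _; rewrite lee_fin norm2sq_ge0.
  under eq_integral do rewrite EFinD.
  rewrite ge0_integralD//=; try (by move=> x _; rewrite lee_fin sqr_ge0);
    try (by apply/measurable_EFinP; first [exact: (msq _ mG1)|exact: (msq _ mG2)]).
  exact: lte_add_pinfty.
have DD : (fun n => energy T (f n)) @ \oo --> \int[area]_(x in interior_of T) (norm2sq (G x)).
  apply: (young_cvg _ _ cD).
  - by apply: Rintegral_ge0 => x _; exact: norm2sq_ge0.
  - by move=> n; apply: integral_ge0 => x _; rewrite lee_fin norm2sq_ge0.
  - move=> n e e0; rewrite /energy -(integral_interior_fin T (continuous_energy (sf n))).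
    rewrite /Rintegral fineK//; apply: le_integral_combination => //;
      try (by move=> x; exact: norm2sq_ge0); try (by rewrite addr_ge0// ?invr_ge0 ltW).
    + by apply: mnorm; [exact: (mgr n).1|exact: (mgr n).2].
    + exact: mnorm.
    + by move=> x; exact: young_norm2sq.
  - move=> n e e0; rewrite /energy -(integral_interior_fin T (continuous_energy (sf n))).
    rewrite /Rintegral fineK//; apply: le_integral_combination => //;
      try (by move=> x; exact: norm2sq_ge0); try (by rewrite addr_ge0// ?invr_ge0 ltW).
    + exact: mnorm.
    + by apply: mnorm; [exact: (mgr n).1|exact: (mgr n).2].
    + move=> x; rewrite (_ : norm2sq (grad (f n) x - G x) = norm2sq (G x - grad (f n) x)).
        exact: young_norm2sq.
      by rewrite /norm2sq !coordE; ring.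
have finB : boundary_integral T (fun x => g x ^+ 2) \is a fin_num.
  by rewrite ge0_fin_numE//; apply: boundary_integral_ge0 => x; exact: sqr_ge0.
have le_bdry (P Q S : R * R -> R) (a b : R) :
    (forall s, s \in sides T ->
     [/\ measurable_fun (`[0, 1] : set (measurableTypeR R)) (fun t => P (side_path s t)),
      measurable_fun (`[0, 1] : set (measurableTypeR R)) (fun t => Q (side_path s t)) &
      measurable_fun (`[0, 1] : set (measurableTypeR R)) (fun t => S (side_path s t))]) ->
    0 <= a -> 0 <= b ->
    (forall x, 0 <= P x) -> (forall x, 0 <= Q x) -> (forall x, 0 <= S x) ->
    (forall x, P x <= a * Q x + b * S x) ->
    (boundary_integral T P <= a%:E * boundary_integral T Q + b%:E * boundary_integral T S)%E.
  move=> mPQS a0 b0 P0 Q0 S0 PQS; rewrite /boundary_integral.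
  have l0 (W : R * R -> R) s : (forall x, 0 <= W x) ->
      (0 <= (Defs.edist s.1 s.2)%:E * \int[mu]_(t in `[0%R, 1%R]) (W (side_path s t))%:E)%E.
    move=> W0; rewrite mule_ge0 ?lee_fin ?euclid_ge0//.
    by apply: integral_ge0 => t _; rewrite lee_fin.
  rewrite !ge0_sume_distrr; try (by move=> s _; exact: l0).
  rewrite -big_split/= big_seq [leRHS]big_seq; apply: lee_sum => s /mPQS[mP mQ mS].
  rewrite muleCA [X in (_ <= _ + X)%E]muleCA -ge0_muleDr; first last.
  - by rewrite mule_ge0 ?lee_fin//; apply: integral_ge0 => t _; rewrite lee_fin.
  - by rewrite mule_ge0 ?lee_fin//; apply: integral_ge0 => t _; rewrite lee_fin.
  apply: lee_wpmul2l; first by rewrite lee_fin euclid_ge0.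
  by apply: le_integral_combination.
have BB : (fun n => bdry_mass T (f n)) @ \oo --> fine (boundary_integral T (fun x => g x ^+ 2)).
  have mS n s : s \in sides T ->
    [/\ measurable_fun (`[0, 1] : set (measurableTypeR R)) (fun t => f n (side_path s t) ^+ 2),
      measurable_fun (`[0, 1] : set (measurableTypeR R)) (fun t => g (side_path s t) ^+ 2) &
      measurable_fun (`[0, 1] : set (measurableTypeR R)) (fun t => (f n (side_path s t) - g (side_path s t)) ^+ 2)].
    move=> /mg mgs; have mfs := measurable_side s (cf n).
    by split; apply: measurable_funX => //; exact: measurable_funB.
  apply: (young_cvg _ _ cB).
  - by apply: fine_ge0; apply: boundary_integral_ge0 => x; exact: sqr_ge0.
  - by move=> n; apply: boundary_integral_ge0 => x; exact: sqr_ge0.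
  - move=> n e e0; rewrite fineK// -boundary_integralE//.
    apply: le_bdry; try (by move=> x; exact: sqr_ge0); try (by rewrite addr_ge0// ?invr_ge0 ltW).
      exact: mS.
    by move=> x; exact: young_sqr.
  - move=> n e e0; rewrite fineK// -boundary_integralE//.
    apply: le_bdry; try (by move=> x; exact: sqr_ge0); try (by rewrite addr_ge0// ?invr_ge0 ltW).
      by move=> s /(mS n)[].
    by move=> x; rewrite -[(f n x - g x) ^+ 2]sqrrN opprB; exact: young_sqr.
have N0 : 0 < \int[area]_(x in interior_of T) (u x ^+ 2).
  rewrite lt_neqAle Rintegral_ge0 ?andbT; last by move=> x _; exact: sqr_ge0.
  apply/eqP => N0; apply: nz.
  have mu2 : measurable_fun (interior_of T : set (plane R)) (fun x => (u x ^+ 2)%:E).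
    by apply/measurable_EFinP; exact: (msq _ mu_).
  have := (@ae_eq_integral_abs _ _ _ area _ mT _ mu2).1.
  have -> : (\int[area]_(x in interior_of T) `|(u x ^+ 2)%:E| = 0)%E.
    under eq_integral => x _ do rewrite gee0_abs ?lee_fin ?sqr_ge0//.
    by rewrite -(fineK finN); congr _%:E; exact/esym.
  move=> /(_ erefl); apply: negligibleS => x /=; apply: contra_not => h Tx.
  by apply/eqP; rewrite -sqrf_eq0; have [->] := h Tx.
have QQ : (fun n => quotient alpha T (f n)) @ \oo --> rayleigh alpha T u G g.
  apply: cvgM; last by apply: cvgV; [rewrite gt_eqF|exact: NN].
  by apply: cvgD; [exact: DD|apply: cvgMr; exact: BB].
near \oo => n.
exists (f n); split => //.
  near: n; exact: (cvgr_gt _ NN).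
near: n; move/cvgrPdist_le : QQ => /(_ _ eps0); exact.
Unshelve. all: by end_near. Qed.

End Density.

(** * Transplantation of functions from a triangle to another *)

Section Transfer.
Context {R : realType}.
Local Notation mu := (@lebesgue_measure R).
Implicit Types (T U : triangle R) (f : R * R -> R).

Definition edgeB T : R * R := vertB T - vertA T.
Definition edgeC T : R * R := vertC T - vertA T.

(** The images of [e1] and [e2] under the linear part of the affine map that sends the
    vertices of [T] to those of [U], in the same order. *)
Definition transfer1 T U : R * R :=
  ((edgeC T).2 / det2 T) *: edgeB U - ((edgeB T).2 / det2 T) *: edgeC U.
Definition transfer2 T U : R * R :=
  ((edgeB T).1 / det2 T) *: edgeC U - ((edgeC T).1 / det2 T) *: edgeB U.
Definition transfer T U : R * R -> R * R :=
  affine (vertA U - (vertA T).1 *: transfer1 T U - (vertA T).2 *: transfer2 T U)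
    (transfer1 T U) (transfer2 T U).

Lemma transferE T U (b c : R) :
  transfer T U (vertA T + b *: edgeB T + c *: edgeC T) =
  vertA U + b *: edgeB U + c *: edgeC U.
Proof.
have := det2_neq0 T; rewrite /transfer /affine /transfer1 /transfer2 /edgeB /edgeC /det2.
by move=> d0; apply: eq_plane; rewrite !coordE; field.
Qed.

Lemma transfer_ray T U (r s : R) :
  transfer T U (vertA T + r *: (side_path (vertB T, vertC T) s - vertA T)) =
  vertA U + r *: (side_path (vertB U, vertC U) s - vertA U).
Proof.
have rayE V : vertA V + r *: (side_path (vertB V, vertC V) s - vertA V) =
    vertA V + (r * (1 - s)) *: edgeB V + (r * s) *: edgeC V :> R * R.
  by rewrite /side_path /edgeB /edgeC; apply: eq_plane; rewrite !coordE /=; ring.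
by rewrite !rayE transferE.
Qed.

Lemma transfer_AB T U (t : R) :
  transfer T U (side_path (vertA T, vertB T) t) = side_path (vertA U, vertB U) t.
Proof.
have sE V : side_path (vertA V, vertB V) t = vertA V + t *: edgeB V + 0 *: edgeC V :> R * R.
  by rewrite scale0r addr0.
by rewrite !sE transferE.
Qed.

Lemma transfer_BC T U (t : R) :
  transfer T U (side_path (vertB T, vertC T) t) = side_path (vertB U, vertC U) t.
Proof.
have sE V : side_path (vertB V, vertC V) t = vertA V + (1 - t) *: edgeB V + t *: edgeC V :> R * R.
  by rewrite /side_path /edgeB /edgeC; apply: eq_plane; rewrite !coordE /=; ring.
by rewrite !sE transferE.
Qed.

Lemma transfer_CA T U (t : R) :
  transfer T U (side_path (vertC T, vertA T) t) = side_path (vertC U, vertA U) t.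
Proof.
have sE V : side_path (vertC V, vertA V) t = vertA V + 0 *: edgeB V + (1 - t) *: edgeC V :> R * R.
  by rewrite /side_path /edgeB /edgeC; apply: eq_plane; rewrite !coordE /=; ring.
by rewrite !sE transferE.
Qed.

Lemma continuous_transfer T U : continuous (transfer T U).
Proof. exact: continuous_affine. Qed.

(** The map respects the rays from the first vertex, so both sides have the same
    expression in the coordinates of [cone_integral]. *)
Lemma integral_transfer T U (F : R * R -> R) : `|det2 T| = `|det2 U| ->
  continuous F -> (forall x, 0 <= F x) ->
  \int[area]_(x in interior_of T) F (transfer T U x) =
  \int[area]_(x in interior_of U) F x.
Proof.
move=> dTU cF F0.
have cFt : continuous (F \o transfer T U).
  by move=> x; apply: continuous_comp; [exact: continuous_transfer|exact: cF].
rewrite /Rintegral; congr fine.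
rewrite (@cone_integral _ _ (EFin \o (F \o transfer T U))); first last.
- by move=> x; rewrite /= lee_fin.
- by apply/measurable_EFinP; exact: (continuous_measurable_plane cFt).
rewrite (@cone_integral _ _ (EFin \o F)); first last.
- by move=> x; rewrite /= lee_fin.
- by apply/measurable_EFinP; exact: (continuous_measurable_plane cF).
rewrite dTU; congr (_ * _)%E; apply: eq_integral => s _; apply: eq_integral => r _.
by rewrite /= transfer_ray.
Qed.

Lemma smooth_transfer T U f : smooth f -> smooth (f \o transfer T U).
Proof. exact: smooth_affine. Qed.

Lemma mass_transfer T U f : `|det2 T| = `|det2 U| -> continuous f ->
  mass T (f \o transfer T U) = mass U f.
Proof.
move=> dTU cf; apply: (@integral_transfer T U (fun x => f x ^+ 2)) => //.
  exact: continuousX2.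
by move=> x; exact: sqr_ge0.
Qed.

(** The squared length of the image of [v] under the transpose of the linear part of
    [transfer T U]: by the chain rule, this is what the transplanted function
    contributes to the Dirichlet integral where [f] has gradient [v]. *)
Definition pullback_norm T U (v : R * R) : R :=
  ((transfer1 T U).1 * v.1 + (transfer1 T U).2 * v.2) ^+ 2 +
  ((transfer2 T U).1 * v.1 + (transfer2 T U).2 * v.2) ^+ 2.

Lemma continuous_pullback T U f : smooth f ->
  continuous (fun x => pullback_norm T U (grad f x)).
Proof.
move=> sf.
have c1 := smooth_continuous (smooth_D1 sf); have c2 := smooth_continuous (smooth_D2 sf).
have cl (v : R * R) : continuous (fun x => v.1 * 'D_e1 f x + v.2 * 'D_e2 f x).
  by move=> x; apply: cvgD; apply: cvgMr; [exact: c1|exact: c2].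
by move=> x; apply: cvgD; [exact: (continuousX2 (cl _))|exact: (continuousX2 (cl _))].
Qed.

Lemma energy_transfer T U f : `|det2 T| = `|det2 U| -> smooth f ->
  energy T (f \o transfer T U) =
  \int[area]_(x in interior_of U) pullback_norm T U (grad f x).
Proof.
move=> dTU sf.
rewrite -(@integral_transfer T U (fun x => pullback_norm T U (grad f x)))//.
- apply: eq_Rintegral => x _; rewrite /norm2sq /grad /pullback_norm/=.
  by rewrite (@derive_val _ _ _ _ _ _ _ (D1_affine _ _ _ x sf))
    (@derive_val _ _ _ _ _ _ _ (D2_affine _ _ _ x sf)).
- exact: continuous_pullback.
- by move=> x; rewrite addr_ge0 ?sqr_ge0.
Qed.

Lemma rot_nondegenerate T :
  ((vertC T).1 - (vertB T).1) * ((vertA T).2 - (vertB T).2)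
      - ((vertC T).2 - (vertB T).2) * ((vertA T).1 - (vertB T).1) != 0.
Proof. by apply: contra_neq (det2_neq0 T) => h; rewrite -h /det2; ring. Qed.

Definition rotation T : triangle R := Triangle (rot_nondegenerate T).

Lemma det2_rot T : det2 (rotation T) = det2 T.
Proof. by rewrite /det2 /=; ring. Qed.

Lemma interior_rot T : interior_of (rotation T) = interior_of T.
Proof.
apply/seteqP; split=> x [a [b [c [a0 b0 c0 abc ->]]]].
  by exists c, a, b; split => //; [rewrite -abc; ring|rewrite /= addrC addrA].
by exists b, c, a; split => //; [rewrite -abc; ring|rewrite /= -addrA addrC].
Qed.

Lemma mass_rot T f : mass (rotation T) f = mass T f.
Proof. by rewrite /mass interior_rot. Qed.

Lemma energy_rot T f : energy (rotation T) f = energy T f.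
Proof. by rewrite /energy interior_rot. Qed.

Lemma euclid_sqr (p q : R * R) : Defs.edist p q ^+ 2 = norm2sq (q - p).
Proof. by rewrite sqr_sqrtr ?norm2sq_ge0. Qed.

Definition perimeter T : R := \sum_(s <- sides T) Defs.edist s.1 s.2.
Definition sum_sqr_sides T : R := \sum_(s <- sides T) Defs.edist s.1 s.2 ^+ 2.

(** Let [a] and [b] be the scalar products of [v] with the two edges of [U] at A.  Each
    of the three terms is a quadratic form in the scalar products of [v] with two
    consecutive edges; their sum only involves [Z = a^2 - a b + b^2], which for an
    equilateral [U] is a multiple of the squared length of [v], by the Gram identity
    for the edges. *)
Lemma pullback_rot_sum T U (L : R) (v : R * R) :
  norm2sq (vertB U - vertA U) = L ^+ 2 -> norm2sq (vertC U - vertB U) = L ^+ 2 ->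
  norm2sq (vertA U - vertC U) = L ^+ 2 -> det2 T ^+ 2 = 3 / 4 * L ^+ 4 ->
  det2 U ^+ 2 = 3 / 4 * L ^+ 4 -> L != 0 ->
  pullback_norm T U v + pullback_norm T (rotation U) v + pullback_norm T (rotation (rotation U)) v =
  sum_sqr_sides T / L ^+ 2 * norm2sq v.
Proof.
move=> AB BC CA dT dU L0.
rewrite /sum_sqr_sides /sides !big_cons big_nil !euclid_sqr /= addr0.
pose a := (edgeB U).1 * v.1 + (edgeB U).2 * v.2.
pose b := (edgeC U).1 * v.1 + (edgeC U).2 * v.2.
pose Z := a ^+ 2 - a * b + b ^+ 2.
have gram : det2 U ^+ 2 * norm2sq v = L ^+ 2 * Z.
  have AC : norm2sq (vertC U - vertA U) = L ^+ 2.
    by rewrite -CA /norm2sq !coordE; ring.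
  have EF : (edgeB U).1 * (edgeC U).1 + (edgeB U).2 * (edgeC U).2 = L ^+ 2 / 2.
    suff : norm2sq (vertB U - vertA U) + norm2sq (vertC U - vertA U) -
        norm2sq (vertC U - vertB U) = 2 * ((edgeB U).1 * (edgeC U).1 + (edgeB U).2 * (edgeC U).2).
      by rewrite AB AC BC => h; lra.
    by rewrite /edgeB /edgeC /norm2sq !coordE; ring.
  transitivity (a ^+ 2 * norm2sq (edgeC U)
     - 2 * a * b * ((edgeB U).1 * (edgeC U).1 + (edgeB U).2 * (edgeC U).2)
     + b ^+ 2 * norm2sq (edgeB U)).
    by rewrite /a /b /edgeB /edgeC /norm2sq /det2 !coordE; ring.
  by rewrite AC EF AB /Z; field.
have ZE : Z = 3 / 4 * L ^+ 2 * norm2sq v.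
  apply: (@mulfI _ (L ^+ 2)); first by rewrite expf_neq0.
  by rewrite -gram dU; ring.
have dT0 := det2_neq0 T.
have Qsum : det2 T ^+ 2 *
     (pullback_norm T U v + pullback_norm T (rotation U) v + pullback_norm T (rotation (rotation U)) v)
   = Z * (norm2sq (vertB T - vertA T) + (norm2sq (vertC T - vertB T) + norm2sq (vertA T - vertC T))).
  rewrite /Z /a /b /pullback_norm /transfer1 /transfer2 /edgeB /edgeC /norm2sq /=.
  move: dT0; set d := det2 T => dT0.
  rewrite /GRing.scale/=; field.
  by [].
apply: (@mulfI _ (det2 T ^+ 2)); first by rewrite expf_neq0.
rewrite Qsum ZE dT; field.
by [].
Qed.

Lemma side_mass_transfer T U f (s : (R * R) * (R * R)) (s' : (R * R) * (R * R)) :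
  (forall t, transfer T U (side_path s t) = side_path s' t) ->
  side_mass (f \o transfer T U) s = side_mass f s'.
Proof. by move=> h; apply: eq_Rintegral => t _; rewrite /= h. Qed.

Lemma bdry_transfer T U f :
  bdry_mass T (f \o transfer T U) =
  Defs.edist (vertA T) (vertB T) * side_mass f (vertA U, vertB U) +
  Defs.edist (vertB T) (vertC T) * side_mass f (vertB U, vertC U) +
  Defs.edist (vertC T) (vertA T) * side_mass f (vertC U, vertA U).
Proof.
rewrite /bdry_mass /sides !big_cons big_nil addr0 addrA /=.
rewrite (side_mass_transfer _ (transfer_AB T U)) (side_mass_transfer _ (transfer_BC T U)).
by rewrite (side_mass_transfer _ (transfer_CA T U)).
Qed.

End Transfer.

(** * Geometry of triangles of given area, and bounds on quotients *)

Section Comparison.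
Context {R : realType}.
Local Notation mu := (@lebesgue_measure R).
Implicit Types (T U : triangle R) (f : R * R -> R).

(** In terms of [a = y + z - x], [b = z + x - y], [c = x + y - z] the hypothesis reads
    [(a + b + c) a b c = 3], and both conclusions follow from
    [(ab + bc + ca)^2 >= 3 (a + b + c) a b c]. *)
Lemma heron_gap (x y z : R) : 0 <= x -> 0 <= y -> 0 <= z ->
  2 * (x ^+ 2 * y ^+ 2 + y ^+ 2 * z ^+ 2 + z ^+ 2 * x ^+ 2)
    - (x ^+ 4 + y ^+ 4 + z ^+ 4) = 3 ->
  3 <= x + y + z /\
  6 * (x ^+ 2 + y ^+ 2 + z ^+ 2) <= 3 * (x + y + z) ^+ 2 - 9.
Proof.
move=> x0 y0 z0 heron.
pose a := y + z - x; pose b := z + x - y; pose c := x + y - z.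
pose s := x + y + z; pose m := a * b + b * c + c * a.
have s0 : 0 <= s by rewrite /s; lra.
have sabc : s * (a * b * c) = 3 by rewrite -heron /s /a /b /c; ring.
have abc0 : 0 < a * b * c.
  have : 0 < s * (a * b * c) by rewrite sabc; lra.
  by rewrite pmulr_rgt0// lt_neqAle s0 andbT; apply/eqP => sz; move: sabc; rewrite -sz; lra.
(* two negative factors would make x, y or z negative *)
have [a0 b0 c0] : [/\ 0 <= a, 0 <= b & 0 <= c].
  have ab : 0 <= a + b by rewrite /a /b; lra.
  have bc : 0 <= b + c by rewrite /b /c; lra.
  have ca : 0 <= c + a by rewrite /a /c; lra.
  case: (leP 0 a) (leP 0 b) (leP 0 c) => [a0|a0] [b0|b0] [c0|c0]; split => //; try lra.
  - suff : a * b * c <= 0 by lra.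
    by rewrite mulr_ge0_le0 ?mulr_ge0// ltW.
  - suff : a * b * c <= 0 by lra.
    by rewrite mulr_le0_ge0// mulr_ge0_le0// ltW.
  - suff : a * b * c <= 0 by lra.
    by rewrite mulr_le0_ge0// mulr_le0_ge0// ltW.
have m0 : 0 <= m by rewrite /m !addr_ge0 ?mulr_ge0.
have m9 : 9 <= m ^+ 2.
  have -> : 9 = 3 * (s * (a * b * c)) by rewrite sabc; ring.
  rewrite -subr_ge0 (_ : _ - _ = ((a * b - b * c) ^+ 2 + (b * c - c * a) ^+ 2 + (c * a - a * b) ^+ 2) / 2).
    by rewrite divr_ge0// !addr_ge0 ?sqr_ge0.
  by rewrite /m /s /a /b /c; field.
have m3 : 3 <= m.
  rewrite leNgt; apply/negP => m3.
  have : m * m <= m * 3 by apply: ler_wpM2l => //; exact: ltW.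
  by move: m9; rewrite expr2; lra.
have sm : 3 * m <= s ^+ 2.
  rewrite -subr_ge0 (_ : _ - _ = ((a - b) ^+ 2 + (b - c) ^+ 2 + (c - a) ^+ 2) / 2).
    by rewrite divr_ge0// !addr_ge0 ?sqr_ge0.
  by rewrite /m /s /a /b /c; field.
split.
  rewrite leNgt; apply/negP => s3.
  have : s * s <= s * 3 by apply: ler_wpM2l => //; exact: ltW.
  by move: sm s3; rewrite -/s expr2; lra.
rewrite -/s (_ : 6 * _ = 3 * s ^+ 2 - 3 * m); first by lra.
by rewrite /m /s /a /b /c; ring.
Qed.

(** Heron's formula, without square roots. *)
Lemma heron T :
  2 * (norm2sq (vertB T - vertA T) * norm2sq (vertC T - vertB T)
     + norm2sq (vertC T - vertB T) * norm2sq (vertA T - vertC T)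
     + norm2sq (vertA T - vertC T) * norm2sq (vertB T - vertA T))
  - (norm2sq (vertB T - vertA T) ^+ 2 + norm2sq (vertC T - vertB T) ^+ 2
     + norm2sq (vertA T - vertC T) ^+ 2) = 4 * det2 T ^+ 2.
Proof. by rewrite /norm2sq /det2 !coordE; ring. Qed.

(** The sum of [trace_ineq] over the three sides, each seen from the opposite vertex.
    The distance from a vertex to a point of the opposite side is at most the longest
    adjacent edge, by convexity. *)
Lemma bdry_trace T f (eps K : R) : smooth f -> 0 < eps ->
  (forall s, s \in sides T -> norm2sq (s.2 - s.1) <= K) ->
  `|det2 T| * bdry_mass T f <=
    perimeter T * ((2 + eps^-1) * mass T f + eps * K * energy T f).
Proof.
move=> sf e0 hK.
have sym (p q : R * R) : norm2sq (p - q) = norm2sq (q - p).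
  by rewrite /norm2sq !coordE; ring.
have conv V : norm2sq (edgeB V) <= K -> norm2sq (edgeC V) <= K ->
    forall s : R, 0 <= s <= 1 -> norm2sq (side_path (vertB V, vertC V) s - vertA V) <= K.
  move=> KB KC s /andP[s0 s1].
  apply: (@le_trans _ _ ((1 - s) * norm2sq (edgeB V) + s * norm2sq (edgeC V))).
    rewrite -subr_ge0 (_ : _ - _ = s * (1 - s) * norm2sq (edgeC V - edgeB V)).
      by rewrite !mulr_ge0 ?norm2sq_ge0// subr_ge0.
    by rewrite /side_path /norm2sq /edgeB /edgeC !coordE/= /GRing.scale/=; ring.
  have -> : K = (1 - s) * K + s * K by ring.
  by apply: lerD; apply: ler_wpM2l => //; rewrite subr_ge0.
have kA : norm2sq (vertB T - vertA T) <= K.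
  by apply: (hK (vertA T, vertB T)); rewrite !inE eqxx.
have kB : norm2sq (vertC T - vertB T) <= K.
  by apply: (hK (vertB T, vertC T)); rewrite !inE eqxx orbT.
have kC : norm2sq (vertA T - vertC T) <= K.
  by apply: (hK (vertC T, vertA T)); rewrite !inE eqxx !orbT.
have t1 := @trace_ineq _ T f eps K sf e0 (conv T kA _).
have t2 := @trace_ineq _ (rotation T) f eps K sf e0 (conv (rotation T) kB _).
have t3 := @trace_ineq _ (rotation (rotation T)) f eps K sf e0 (conv (rotation (rotation T)) kC _).
rewrite !mass_rot !energy_rot !det2_rot /edgeC/= in t1 t2 t3.
rewrite /bdry_mass /perimeter mulr_sumr mulr_suml /sides !big_cons !big_nil !addr0 /=.
have e := @euclid_ge0 R.
have {}t1 := ler_wpM2l (e (vertB T) (vertC T)) (t1 ltac:(by rewrite sym)).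
have {}t2 := ler_wpM2l (e (vertC T) (vertA T)) (t2 ltac:(by rewrite sym)).
have {}t3 := ler_wpM2l (e (vertA T) (vertB T)) (t3 ltac:(by rewrite sym)).
by apply: lerD; [|apply: lerD]; rewrite mulrCA.
Qed.

Lemma perimeter_ge0 T : 0 <= perimeter T.
Proof. by apply: sumr_ge0 => s _; exact: euclid_ge0. Qed.

Lemma det2_gt0 T : 0 < `|det2 T|.
Proof. by rewrite normr_gt0 det2_neq0. Qed.

(** The trace inequality with [eps] so small that the Dirichlet integral absorbs its
    share of the boundary term. *)
Lemma quotient_bounded_below alpha T : alpha < 0 ->
  exists C : R, forall f, smooth f -> 0 < mass T f -> C <= quotient alpha T f.
Proof.
move=> a0; pose K := sum_sqr_sides T + 1.
have K0 : 0 < K by rewrite ltr_wpDl// sumr_ge0// => s _; exact: sqr_ge0.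
have hK s : s \in sides T -> norm2sq (s.2 - s.1) <= K.
  have := @sqr_ge0 R; rewrite /K /sum_sqr_sides /sides !big_cons big_nil !inE !euclid_sqr/= => _.
  have h1 := norm2sq_ge0 (vertB T - vertA T); have h2 := norm2sq_ge0 (vertC T - vertB T).
  have h3 := norm2sq_ge0 (vertA T - vertC T).
  by case/or3P => /eqP -> /=; lra.
have d0 := det2_gt0 T; set d := `|det2 T| in d0.
pose c := - alpha * (perimeter T + 1) / d.
have P0 := perimeter_ge0 T.
have c0 : 0 < c by rewrite /c divr_gt0// mulr_gt0//; lra.
pose eps := (c * K)^-1.
have e0 : 0 < eps by rewrite invr_gt0 mulr_gt0.
exists (- (c * (2 + eps^-1))) => f sf m0.
rewrite ler_pdivlMr//.
have h := bdry_trace sf e0 hK; rewrite -/d in h.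
set W := _ + _ in h.
have W0 : 0 <= W.
  rewrite addr_ge0// mulr_ge0 ?energy_ge0 ?mulr_ge0 ?(ltW K0) ?(ltW e0) ?(ltW m0)//.
  by rewrite addr_ge0// invr_ge0 ltW.
have h1 : - alpha * bdry_mass T f <= c * W.
  have -> : c * W = - alpha * ((perimeter T + 1) * W / d) by rewrite /c; ring.
  apply: ler_wpM2l; first lra.
  rewrite ler_pdivlMr// mulrC; apply: (le_trans h).
  by apply: ler_wpM2r => //; lra.
have cW : c * W = c * (2 + eps^-1) * mass T f + energy T f.
  by rewrite /W /eps; field; rewrite !gt_eqF.
by move: h1; rewrite cW; lra.
Qed.

Lemma robin_set_lbound alpha T : alpha < 0 ->
  has_lbound [set r | exists u G g,
    [/\ H1 (interior_of T) u G, trace T u G g,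
        ~ {ae area, forall x, interior_of T x -> u x = 0} &
        r = rayleigh alpha T u G g]].
Proof.
move=> a0; have [C hC] := quotient_bounded_below T a0.
exists (C - 1) => _ [u [G [g [Hu Tu nz ->]]]].
have [f [sf m0]] := smooth_dense alpha Hu Tu nz ltr01.
have := hC f sf m0.
by rewrite ler_norml => h1 /andP[h2 h3]; lra.
Qed.

Lemma mass_cst1 T : mass T (fun=> 1) = `|det2 T| / 2.
Proof.
rewrite /mass /Rintegral; under eq_integral do rewrite expr1n.
rewrite integral_cst; last exact: measurable_interior.
by rewrite mul1e; have := area_interior T => /= ->.
Qed.

Lemma quotient_cst1 alpha T : quotient alpha T (fun=> 1) = 2 * alpha * perimeter T / `|det2 T|.
Proof.
rewrite /quotient mass_cst1.
have -> : energy T (fun=> 1) = 0.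
  rewrite /energy /Rintegral integral0_eq// => x _.
  by rewrite /norm2sq /grad /= !derive_cst !expr0n addr0.
have -> : bdry_mass T (fun=> 1) = perimeter T.
  apply: eq_bigr => s _; rewrite /side_mass Rintegral_cst//= lebesgue_measure_itv/= lte_fin ltr01.
  by rewrite expr1n mul1r oppr0 addr0 mulr1.
have := det2_gt0 T => d0; field; by rewrite gt_eqF.
Qed.

Lemma robin_lambda1_le alpha T f : alpha < 0 -> smooth f -> 0 < mass T f ->
  robin_lambda1 alpha T <= quotient alpha T f.
Proof.
move=> a0 sf m0; apply: ge_inf; first exact: robin_set_lbound.
exact: smooth_admissible.
Qed.

Lemma robin_lambda1_ge alpha T (x : R) :
  (forall f, smooth f -> 0 < mass T f -> x <= quotient alpha T f) ->
  x <= robin_lambda1 alpha T.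
Proof.
move=> h; apply: lb_le_inf.
  exists (quotient alpha T (fun=> 1)); apply: smooth_admissible; first exact: smooth_cst.
  by rewrite mass_cst1 divr_gt0 ?det2_gt0.
move=> _ [u [G [g [Hu Tu nz ->]]]]; apply/ler_addgt0Pr => e e0.
have [f [sf m0]] := smooth_dense alpha Hu Tu nz e0.
by have := h f sf m0; rewrite ler_norml => h1 /andP[h2 h3]; lra.
Qed.

End Comparison.

(** * Comparison with the equilateral triangle *)

Section Main.
Context {R : realType}.
Implicit Types (T U : triangle R) (f : R * R -> R).

(** The real inequality behind the comparison: [b] is [- alpha], [P] and [Q] are the
    perimeter and the sum of the squared sides of the competing triangle.  The first
    alternative says that the constant function does well enough there, the second
    that the average of the three transplanted functions does. *)
Lemma comparison_algebra (L d P Q b N D B : R) :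
  0 < L -> 0 < d -> d ^+ 2 = 3 / 4 * L ^+ 4 -> 0 < b -> 48 * b * d <= L ->
  0 < N -> 0 <= D -> 3 * L <= P -> 6 * Q <= 3 * P ^+ 2 - 9 * L ^+ 2 ->
  (forall eps, 0 < eps -> d * B <= 3 * L * ((2 + eps^-1) * N + eps * L ^+ 2 * D)) ->
  - (2 * b * P / d) * N <= D - b * B \/
  Q / L ^+ 2 * D - b * (P / L * B) <= 3 * (D - b * B).
Proof.
move=> L0 d0 dL b0 bdL N0 D0 LP QP tr.
have Ln0 : L != 0 by rewrite gt_eqF.
have dn0 : d != 0 by rewrite gt_eqF.
have bn0 : b != 0 by rewrite gt_eqF.
pose k := L / d; pose p := P / (3 * L); pose q := Q / (3 * L ^+ 2).
have PE : P = 3 * p * L by rewrite /p; field.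
have QE : Q = 3 * q * L ^+ 2 by rewrite /q; field.
have k0 : 0 < k by rewrite divr_gt0.
have kL : k ^+ 2 * L ^+ 2 = 4 / 3.
  have -> : k ^+ 2 * L ^+ 2 = L ^+ 4 / d ^+ 2 by rewrite /k; field.
  by rewrite dL; field.
have kb : 48 * b <= k by rewrite ler_pdivlMr.
have p1 : 1 <= p by rewrite ler_pdivlMr ?mul1r//; lra.
have q1 : 2 * q <= 3 * p ^+ 2 - 1.
  have L2 : 0 < 9 * L ^+ 2 by rewrite mulr_gt0// exprn_gt0.
  by rewrite -(ler_pM2l L2); move: QP; rewrite PE QE; lra.
have [|lt1] := leP (- (2 * b * P / d) * N) (D - b * B); [by left|right].
have PdE : 2 * b * P / d = 6 * (b * k) * p by rewrite PE /k; field.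
rewrite PdE in lt1.
have bk : 0 < b * k by rewrite mulr_gt0.
have bkN : 0 < b * k * N by rewrite mulr_gt0.
have bB : b * B <= 6 * (b * k) * N + 24 * b ^+ 2 * N + D / 2.
  (* the value for which the gradient term of [tr], times [b / d], is [D / 2] *)
  pose eps := (6 * k * b * L ^+ 2)^-1.
  have e0 : 0 < eps by rewrite invr_gt0 mulr_gt0 ?exprn_gt0// mulr_gt0// mulr_gt0//.
  have := tr eps e0; rewrite -(ler_pM2l (divr_gt0 b0 d0)).
  have -> : b / d * (d * B) = b * B by field.
  have -> : b / d * (3 * L * ((2 + eps^-1) * N + eps * L ^+ 2 * D)) =
      6 * (b * k) * N + 18 * b ^+ 2 * (k ^+ 2 * L ^+ 2) * N + D / 2.
    by rewrite /eps /k; field; rewrite ?Ln0 ?dn0 ?bn0.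
  by rewrite kL; lra.
have bb : 48 * b ^+ 2 * N <= b * k * N.
  by rewrite ler_pM2r// -subr_ge0 (_ : _ - _ = b * (k - 48 * b)) ?mulr_ge0 ?subr_ge0// ?ltW//; ring.
have Dlt : D < b * k * N - 12 * (p - 1) * (b * k * N) by lra.
have [p2|p2] := leP 2 p.
  have : 1 * (b * k * N) <= (p - 1) * (b * k * N) by apply: ler_wpM2r; lra.
  by lra.
have Dle : D <= b * k * N.
  have : 0 <= (p - 1) * (b * k * N) by rewrite mulr_ge0//; lra.
  by lra.
have -> : Q / L ^+ 2 * D = 3 * (q * D) by rewrite QE; field.
have -> : b * (P / L * B) = 3 * (p * (b * B)) by rewrite PE; field.
have h1 : (p - 1) * (6 * (b * k * N)) <= (p - 1) * (b * B).
  apply: ler_wpM2l; first lra.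
  have : 1 * (b * k * N) <= p * (b * k * N) by apply: ler_wpM2r; lra.
  by lra.
have h2 : (q - 1) * D <= (9 / 2 * (p - 1)) * D.
  apply: ler_wpM2r => //.
  have : p * p <= p * 2 by apply: ler_wpM2l; lra.
  have : (p - 1) * p <= (p - 1) * 2 by apply: ler_wpM2l; lra.
  by move: q1; rewrite expr2; lra.
have h3 : (9 / 2 * (p - 1)) * D <= (9 / 2 * (p - 1)) * (b * k * N).
  by apply: ler_wpM2l => //; lra.
have h4 : 0 <= (p - 1) * (b * k * N) by rewrite mulr_ge0//; lra.
lra.
Qed.

Lemma le_third_of_sum (alpha x1 x2 x3 y1 y2 y3 D B : R) :
  x1 + x2 + x3 - - alpha * (y1 + y2 + y3) <= 3 * (D - - alpha * B) ->
  D + alpha * B < x1 + alpha * y1 -> D + alpha * B < x2 + alpha * y2 ->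
  x3 + alpha * y3 <= D + alpha * B.
Proof. by lra. Qed.

Lemma smooth_comparison (alpha L : R) T U f :
  Defs.edist (vertA U) (vertB U) = L -> Defs.edist (vertB U) (vertC U) = L ->
  Defs.edist (vertC U) (vertA U) = L -> `|det2 T| = `|det2 U| ->
  alpha < 0 -> 48 * - alpha * `|det2 U| <= L ->
  smooth f -> 0 < mass U f ->
  exists g, [/\ smooth g, 0 < mass T g & quotient alpha T g <= quotient alpha U f].
Proof.
move=> AB BC CA dTU a0 adL sf m0.
have cf := smooth_continuous sf.
have L_ge0 : 0 <= L by rewrite -AB euclid_ge0.
have nAB : norm2sq (vertB U - vertA U) = L ^+ 2 by rewrite -euclid_sqr AB.
have nBC : norm2sq (vertC U - vertB U) = L ^+ 2 by rewrite -euclid_sqr BC.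
have nCA : norm2sq (vertA U - vertC U) = L ^+ 2 by rewrite -euclid_sqr CA.
have dU : det2 U ^+ 2 = 3 / 4 * L ^+ 4.
  by have := heron U; rewrite nAB nBC nCA => h; apply: (@mulfI _ 4) => //; rewrite -h; field.
have dT : det2 T ^+ 2 = 3 / 4 * L ^+ 4.
  by rewrite -dU -[LHS]real_normK ?num_real// dTU real_normK ?num_real.
have Ln0 : L != 0.
  apply/eqP => L0; have := det2_neq0 U; rewrite -sqrf_eq0 dU L0.
  by rewrite expr0n mulr0 eqxx.
have L0 : 0 < L by rewrite lt_neqAle eq_sym Ln0.
have d0 := det2_gt0 U; set d := `|det2 U| in d0 dTU adL.
have d2 : d ^+ 2 = 3 / 4 * L ^+ 4 by rewrite real_normK ?num_real.
have b0 : 0 < - alpha by lra.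
pose l1 := Defs.edist (vertA T) (vertB T); pose l2 := Defs.edist (vertB T) (vertC T).
pose l3 := Defs.edist (vertC T) (vertA T).
have PE : perimeter T = l1 + l2 + l3.
  by rewrite /perimeter /sides !big_cons big_nil addr0 addrA.
have QE : sum_sqr_sides T = l1 ^+ 2 + l2 ^+ 2 + l3 ^+ 2.
  by rewrite /sum_sqr_sides /sides !big_cons big_nil addr0 addrA.
have [LP QP] : 3 * L <= perimeter T /\
    6 * sum_sqr_sides T <= 3 * perimeter T ^+ 2 - 9 * L ^+ 2.
  have [] := @heron_gap _ (l1 / L) (l2 / L) (l3 / L).
  - by rewrite divr_ge0 ?euclid_ge0.
  - by rewrite divr_ge0 ?euclid_ge0.
  - by rewrite divr_ge0 ?euclid_ge0.
  - have := heron T; rewrite -!euclid_sqr -/l1 -/l2 -/l3 dT => h.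
    apply: (@mulIf _ (L ^+ 4)); first by rewrite expf_neq0.
    by transitivity (4 * (3 / 4 * L ^+ 4)); [rewrite -h; field|field].
  rewrite -!mulrDl ler_pdivlMr// -PE => LP h; split => //.
  have L2 : 0 < L ^+ 2 by rewrite exprn_gt0.
  have -> : sum_sqr_sides T = ((l1 / L) ^+ 2 + (l2 / L) ^+ 2 + (l3 / L) ^+ 2) * L ^+ 2.
    by rewrite QE; field.
  rewrite mulrA; apply: (le_trans (ler_wpM2r (ltW L2) h)).
  by rewrite le_eqVlt; apply/orP; left; apply/eqP; field.
have trace_est eps : 0 < eps -> d * bdry_mass U f <=
    3 * L * ((2 + eps^-1) * mass U f + eps * L ^+ 2 * energy U f).
  move=> e0; have -> : 3 * L = perimeter U.
    by rewrite /perimeter /sides !big_cons big_nil AB BC CA; ring.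
  apply: bdry_trace => // s; rewrite !inE => /or3P[] /eqP -> /=.
  - by rewrite nAB.
  - by rewrite nBC.
  - by rewrite nCA.
have BE : bdry_mass U f = L * (side_mass f (vertA U, vertB U) +
    side_mass f (vertB U, vertC U) + side_mass f (vertC U, vertA U)).
  by rewrite /bdry_mass /sides !big_cons big_nil AB BC CA; ring.
have [cst_ok|sum_le] := comparison_algebra L0 d0 d2 b0 adL m0 (energy_ge0 U f) LP QP trace_est.
  exists (fun=> 1); split; first exact: smooth_cst.
    by rewrite mass_cst1 divr_gt0 ?det2_gt0.
  rewrite quotient_cst1 dTU ler_pdivlMr//.
  move: cst_ok; rewrite (_ : - (2 * - alpha * perimeter T / d) = 2 * alpha * perimeter T / d).
    by rewrite mulNr opprK.
  by ring.
pose V1 := rotation U; pose V2 := rotation V1.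
have d1 : `|det2 T| = `|det2 V1| by rewrite det2_rot.
have d2' : `|det2 T| = `|det2 V2| by rewrite !det2_rot.
have Esum : energy T (f \o transfer T U) + energy T (f \o transfer T V1) + energy T (f \o transfer T V2) =
    sum_sqr_sides T / L ^+ 2 * energy U f.
  rewrite !energy_transfer// !interior_rot /energy -RintegralZl; last 2 first.
  - exact: measurable_interior.
  - by apply: continuous_integrable_interior; exact: continuous_energy.
  have mU := measurable_interior U.
  have iQ V := continuous_integrable_interior U (@continuous_pullback _ T V f sf).
  rewrite -!RintegralD//; last first.
    apply: continuous_integrable_interior => x.
    by apply: cvgD; exact: continuous_pullback.
  apply: eq_Rintegral => x _; exact: (@pullback_rot_sum _ T U L (grad f x)).
have Bsum : bdry_mass T (f \o transfer T U) + bdry_mass T (f \o transfer T V1) +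
    bdry_mass T (f \o transfer T V2) =
    perimeter T / L * bdry_mass U f.
  by rewrite !bdry_transfer BE PE /V1 /V2 /= -/l1 -/l2 -/l3; field.
have good V : `|det2 T| = `|det2 V| -> mass V f = mass U f ->
    energy T (f \o transfer T V) + alpha * bdry_mass T (f \o transfer T V) <=
    energy U f + alpha * bdry_mass U f ->
    exists g, [/\ smooth g, 0 < mass T g & quotient alpha T g <= quotient alpha U f].
  move=> dV mV h; exists (f \o transfer T V); split.
  - exact: smooth_transfer.
  - by rewrite (mass_transfer dV cf) mV.
  - rewrite /quotient (mass_transfer dV cf) mV; apply: ler_wpM2r; last exact: h.
    by rewrite invr_ge0; exact: ltW.
have [h|h0] := leP (energy T (f \o transfer T U) + alpha * bdry_mass T (f \o transfer T U))
    (energy U f + alpha * bdry_mass U f); first exact: good h.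
have [h|h1] := leP (energy T (f \o transfer T V1) + alpha * bdry_mass T (f \o transfer T V1))
    (energy U f + alpha * bdry_mass U f).
  by apply: good d1 _ h; exact: mass_rot.
apply: (good V2 d2'); first by rewrite !mass_rot.
rewrite -Esum -Bsum in sum_le; exact: le_third_of_sum sum_le h0 h1.
Qed.

Lemma robin_lambda1_lt0 (alpha : R) T : alpha < 0 -> robin_lambda1 alpha T < 0.
Proof.
move=> a0; have m1 : 0 < mass T (fun=> 1) by rewrite mass_cst1 divr_gt0 ?det2_gt0.
apply: le_lt_trans (robin_lambda1_le a0 (smooth_cst 1) m1) _.
rewrite quotient_cst1 pmulr_llt0 ?invr_gt0 ?det2_gt0//.
rewrite nmulr_rlt0; last by lra.
rewrite lt_neqAle perimeter_ge0 andbT; apply/eqP => P0.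
have := det2_neq0 T; rewrite -sqrf_eq0 => /eqP; apply.
have e1 := euclid_ge0 (vertA T) (vertB T); have e2 := euclid_ge0 (vertB T) (vertC T).
have e3 := euclid_ge0 (vertC T) (vertA T).
move: P0; rewrite /perimeter /sides !big_cons big_nil /= => P0.
have := heron T; rewrite -!euclid_sqr.
have -> : Defs.edist (vertA T) (vertB T) = 0 by lra.
have -> : Defs.edist (vertB T) (vertC T) = 0 by lra.
have -> : Defs.edist (vertC T) (vertA T) = 0 by lra.
by rewrite !expr0n /=; lra.
Qed.

End Main.

Theorem theorem1p1 (R : realType) (S : R) (S_gt0 : 0 < S) :
  exists2 alpha0 : R, alpha0 < 0 &
  forall alpha : R, alpha0 <= alpha -> alpha < 0 ->
  exists2 delta : R, 0 < delta &
  forall Tstar T : triangle R,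
    equilateral Tstar ->
    area (interior_of Tstar) = S%:E ->
    area (interior_of T) = S%:E ->
    (area (interior_of T `\` interior_of Tstar) < delta%:E)%E ->
    1 <= robin_lambda1 alpha T / robin_lambda1 alpha Tstar.
Proof.
pose rS := Num.sqrt (2 * S).
have rS0 : 0 < rS by rewrite sqrtr_gt0 mulr_gt0.
(* [rS] is a lower bound of the side, and [rS ^+ 2] is the determinant *)
exists (- (48 * rS)^-1); first by rewrite oppr_lt0 invr_gt0 mulr_gt0.
move=> alpha a0 alpha_lt0; exists 1 => // U T [AB BC] areaU areaT _.
have detE V : area (interior_of V) = S%:E -> `|det2 V| = 2 * S.
  by rewrite area_interior => -[h]; lra.
pose L := Defs.edist (vertA U) (vertB U).
have dU := detE U areaU; have dT := detE T areaT.
have L_ge0 : 0 <= L by exact: euclid_ge0.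
have d2 : (2 * S) ^+ 2 = 3 / 4 * L ^+ 4.
  have := heron U; rewrite -!euclid_sqr -BC -AB -/L -[det2 U ^+ 2]real_normK ?num_real// dU => h.
  by apply: (@mulfI _ 4) => //; rewrite -h; field.
have SL : 2 * S <= L ^+ 2.
  rewrite -(@ler_pXn2r _ 2)// ?nnegrE ?exprn_ge0//; last by lra.
  by rewrite d2 -exprM; have := exprn_ge0 4 L_ge0; lra.
have rL : rS <= L by rewrite -(ger0_norm L_ge0) -sqrtr_sqr ler_wsqrtr.
have small : 48 * - alpha * `|det2 U| <= L.
  apply: le_trans rL; rewrite dU -(@sqr_sqrtr _ (2 * S)) -/rS; last by lra.
  have : - alpha <= (48 * rS)^-1 by rewrite lerNl.
  rewrite -(ler_pM2l (mulr_gt0 _ (exprn_gt0 2 rS0) : 0 < 48 * rS ^+ 2))//.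
  by rewrite (_ : 48 * rS ^+ 2 / (48 * rS) = rS); [lra|field; rewrite gt_eqF].
rewrite ler_ndivlMr ?robin_lambda1_lt0// mul1r.
apply: robin_lambda1_ge => f sf m0.
have [g [sg mg gf]] : exists g, [/\ smooth g, 0 < mass T g & quotient alpha T g <= quotient alpha U f].
  by apply: (@smooth_comparison R alpha L) => //; rewrite ?dU ?dT// /L AB// BC.
by apply: le_trans gf; exact: robin_lambda1_le.
Qed.
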